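(* The Lie algebra of Noether symmetries associated to the charged squashed Kaluza–Klein black hole metric $$ds^2=-f(r)\,dt^2+\frac{k^2(r)}{f(r)}\,dr^2+\frac{r^2}{4}\left[k(r)(\sigma_1^2+\sigma_2^2)+\sigma_3^2\right],$$ i.e. of Noether point symmetries of its geodesic Lagrangian $\mathcal L$, has dimension six, with basis $$\mathbf Y_1=\frac{\partial}{\partial s},\quad \mathbf Y_2=\frac{\partial}{\partial t},\quad \mathbf Y_3=\frac{\partial}{\partial\varphi},\quad \mathbf Y_4=\frac{\partial}{\partial\psi},$$ $$\mathbf Y_5=\sin\varphi\,\frac{\partial}{\partial\theta}+\cos\varphi\cot\theta\,\frac{\partial}{\partial\varphi}-\cos\varphi\csc\theta\,\frac{\partial}{\partial\psi},$$ $$\mathbf Y_6=\cos\varphi\,\frac{\partial}{\partial\theta}-\sin\varphi\cot\theta\,\frac{\partial}{\partial\varphi}+\sin\varphi\csc\theta\,\frac{\partial}{\partial\psi}.$$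
   Context: The coordinates are $(t,r,\theta,\varphi,\psi)$ with $0\le\theta<\pi$, $0\le\varphi<2\pi$, $0\le\psi<2\pi$, $0<r<r_\infty$ (restricted to the open region where the metric is defined and nondegenerate), and $$\sigma_1=\cos\psi\,d\theta+\sin\psi\sin\theta\,d\varphi,\quad \sigma_2=-\sin\psi\,d\theta+\cos\psi\sin\theta\,d\varphi,\quad \sigma_3=d\psi+\cos\theta\,d\varphi,$$ $$f(r)=1-\frac{2M}{r^2}+\frac{q^2}{r^4},\qquad k(r)=\frac{f(r_\infty)\,r_\infty^4}{(r^2-r_\infty^2)^2},$$ where $M$ and $q$ are real constants (the mass and the charge of the black hole), $q\neq0$, and $r_\infty>0$ is a constant. Write $(x^1,\dots,x^5)=(t,r,\theta,\varphi,\psi)$ and let the dot denote $d/ds$. The geodesic Lagrangian is $\mathcal L(s,x,\dot x)=g_{\mu\nu}(x)\dot x^\mu\dot x^\nu$, that is, $$\mathcal L=-f(r)\dot t^2+\frac{k^2(r)}{f(r)}\dot r^2+\frac{r^2}{4}k(r)\dot\theta^2+\frac{r^2}{4}\left[k(r)\sin^2\theta+\cos^2\theta\right]\dot\varphi^2+\frac{r^2}{2}\cos\theta\,\dot\varphi\dot\psi+\frac{r^2}{4}\dot\psi^2 .$$ For $\mathbf Y=\xi(s,x)\frac{\partial}{\partial s}+\eta^\nu(s,x)\frac{\partial}{\partial x^\nu}$ the first prolongation is $$\mathbf Y^{[1]}=\mathbf Y+\left(\eta^\nu_{,s}+\eta^\nu_{,\mu}\dot x^\mu-\xi_{,s}\dot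 x^\nu-\xi_{,\mu}\dot x^\mu\dot x^\nu\right)\frac{\partial}{\partial\dot x^\nu}.$$ $\mathbf Y$ is a Noether point symmetry of $\mathcal L$ if there is a gauge function $A(s,x)$ such that $\mathbf Y^{[1]}\mathcal L+(D_s\xi)\mathcal L=D_sA$, where $D_s=\frac{\partial}{\partial s}+\dot x^\mu\frac{\partial}{\partial x^\mu}$.
   Formalization: Stated for every nonempty connected open subset of the region where the metric is defined and nondegenerate; if f vanishes at horizons in (0, r_∞), the whole region is disconnected and the dimension there exceeds six. *)

(* Defs.v *)
From HB Require Import structures.
From mathcomp Require Import all_boot all_order all_algebra.
From mathcomp Require Import all_classical all_reals all_analysis.
From mathcomp Require Import ring.

Set Implicit Arguments.
Unset Strict Implicit.
Unset Printing Implicit Defensive.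

Import Order.TTheory GRing.Theory Num.Theory.
Import numFieldNormedType.Exports.

Local Open Scope classical_set_scope.
Local Open Scope ring_scope.

(* A point x : 'rV[R]_5 has the coordinates
     x 0 0 = t, x 0 1 = r, x 0 2 = theta, x 0 3 = phi, x 0 4 = psi,
   and a velocity v : 'rV[R]_5 is indexed in the same way. The functions xi,
   eta^nu and the gauge function depend on (s, x) : R * 'rV[R]_5, and a vector
   field xi d/ds + eta^nu d/dx^nu is the function (s, x) |-> (xi, eta). Such
   functions are total; only their values on the domain at hand matter. *)

Section Smooth.
Context {R : realType} {V W : normedModType R}.

(* Every iterated directional derivative of F, along constant directions, is
   Frechet differentiable at each point of A. For A open in a finite
   dimensional V, this says that F is C^infinity on A. *)
Definition smooth_on (A : set V) (F : V -> W) : Prop :=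
  forall (l : seq V) (p : V), A p ->
    differentiable (foldr (fun v G => (fun q => 'D_v G q)) F l) p.

End Smooth.

Section VectorFields.
Context {R : realType} {E : normedModType R}.

Definition lie_bracket (Y Z : E -> E) : E -> E :=
  fun p => 'D_(Y p) Z p - 'D_(Z p) Y p.

Definition lie_algebra (P : set (E -> E)) : Prop :=
  [/\ P (fun=> 0),
      forall (a b : R) Y Z, P Y -> P Z -> P (fun p => a *: Y p + b *: Z p) &
      forall Y Z, P Y -> P Z -> P (lie_bracket Y Z)].

(* Vector fields are compared on D only: two fields that agree on D are the
   same element. *)
Definition basis_on (D : set E) (P : set (E -> E)) (n : nat)
    (b : n.-tuple (E -> E)) : Prop :=
  [/\ forall i : 'I_n, P (tnth b i),
      forall c : 'I_n -> R,
        (forall p, D p -> \sum_(i < n) c i *: tnth b i p = 0) ->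
        forall i, c i = 0 &
      forall Y, P Y -> exists c : 'I_n -> R,
        forall p, D p -> Y p = \sum_(i < n) c i *: tnth b i p].

End VectorFields.

Section Noether.
Context {R : realType}.
Local Notation X := 'rV[R]_5.
Local Notation J := (R * 'rV[R]_5)%type.

Definition d_s : J := (1, 0).
Definition d_x (nu : 'I_5) : J := (0, delta_mx 0 nu).

Definition xi (Y : J -> J) (p : J) : R := (Y p).1.
Definition eta (Y : J -> J) (nu : 'I_5) (p : J) : R := (Y p).2 0 nu.

(* Y^[1] applied to a function F(s, x, dot x). *)
Definition prolong1 (Y : J -> J) (F : J -> X -> R) (p : J) (v : X) : R :=
  xi Y p * 'D_d_s (fun q => F q v) p
  + \sum_(nu < 5) eta Y nu p * 'D_(d_x nu) (fun q => F q v) p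
  + \sum_(nu < 5)
      ('D_d_s (eta Y nu) p
       + \sum_(mu < 5) 'D_(d_x mu) (eta Y nu) p * v 0 mu
       - 'D_d_s (xi Y) p * v 0 nu
       - \sum_(mu < 5) 'D_(d_x mu) (xi Y) p * v 0 mu * v 0 nu)
      * 'D_(delta_mx 0 nu) (F p) v.

Definition total_s (A : J -> R) (p : J) (v : X) : R :=
  'D_d_s A p + \sum_(mu < 5) v 0 mu * 'D_(d_x mu) A p.

Definition noether_symmetry (D : set J) (L : J -> X -> R) (Y : J -> J) : Prop :=
  smooth_on D Y /\
  exists A : J -> R, smooth_on D A /\
    forall (p : J) (v : X), D p ->
      prolong1 Y L p v + total_s (xi Y) p v * L p v = total_s A p v.

End Noether.

Section BlackHole.
Context {R : realType}.
Local Notation X := 'rV[R]_5.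
Local Notation J := (R * 'rV[R]_5)%type.

Definition sigma1 (x v : X) : R :=
  cos (x 0 4) * v 0 2 + sin (x 0 4) * sin (x 0 2) * v 0 3.
Definition sigma2 (x v : X) : R :=
  - sin (x 0 4) * v 0 2 + cos (x 0 4) * sin (x 0 2) * v 0 3.
Definition sigma3 (x v : X) : R := v 0 4 + cos (x 0 2) * v 0 3.

Variables M q rinf : R.

Definition bh_f (r : R) : R := 1 - 2 * M / r ^+ 2 + q ^+ 2 / r ^+ 4.
Definition bh_k (r : R) : R :=
  bh_f rinf * rinf ^+ 4 / (r ^+ 2 - rinf ^+ 2) ^+ 2.

Definition bh_metric (x v w : X) : R :=
  let r := x 0 1 in
  - bh_f r * v 0 0 * w 0 0
  + bh_k r ^+ 2 / bh_f r * v 0 1 * w 0 1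
  + r ^+ 2 / 4 *
    (bh_k r * (sigma1 x v * sigma1 x w + sigma2 x v * sigma2 x w)
     + sigma3 x v * sigma3 x w).

Definition nondegenerate_at (x : X) : Prop :=
  forall v : X, (forall w : X, bh_metric x v w = 0) -> v = 0.

(* The condition f(r) != 0 says that the coefficient k^2 / f is defined;
   r != 0 and r != rinf follow from the range of r. The ranges of the angles
   are the interiors of [0, pi[ and [0, 2 pi[. *)
Definition bh_region : set X :=
  [set x : X | [/\ 0 < x 0 1 < rinf, 0 < x 0 2 < pi,
               0 < x 0 3 < 2 * pi, 0 < x 0 4 < 2 * pi &
               bh_f (x 0 1) != 0 /\ nondegenerate_at x]].

Definition bh_lagrangian (p : J) (v : X) : R := bh_metric p.2 v v.

Lemma bh_lagrangianE (s : R) (x v : X) :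
  let r := x 0 1 in let th := x 0 2 in
  bh_lagrangian (s, x) v =
    - bh_f r * v 0 0 ^+ 2
    + bh_k r ^+ 2 / bh_f r * v 0 1 ^+ 2
    + r ^+ 2 / 4 * bh_k r * v 0 2 ^+ 2
    + r ^+ 2 / 4 * (bh_k r * sin th ^+ 2 + cos th ^+ 2) * v 0 3 ^+ 2
    + r ^+ 2 / 2 * cos th * v 0 3 * v 0 4
    + r ^+ 2 / 4 * v 0 4 ^+ 2.
Proof.
rewrite /= /bh_lagrangian /bh_metric /sigma1 /sigma2 /sigma3 /=.
have := cos2Dsin2 (x 0 4).
move: (cos (x 0 4)) (sin (x 0 4)) => c d /eqP; rewrite -subr_eq0 => /eqP h.
apply/eqP; rewrite -subr_eq0; apply/eqP.
transitivity ((c ^+ 2 + d ^+ 2 - 1) * ((x 0 1) ^+ 2 / 4 * bh_k (x 0 1) *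
  (v 0 2 ^+ 2 + sin (x 0 2) ^+ 2 * v 0 3 ^+ 2))); last by rewrite h mul0r.
by move: (_ / bh_f _) => z; field.
Qed.

End BlackHole.

Section Generators.
Context {R : realType}.
Local Notation J := (R * 'rV[R]_5)%type.

Definition cot (x : R) : R := cos x / sin x.
Definition csc (x : R) : R := (sin x)^-1.

Definition bh_Y1 : J -> J := fun=> d_s.
Definition bh_Y2 : J -> J := fun=> d_x 0.
Definition bh_Y3 : J -> J := fun=> d_x 3.
Definition bh_Y4 : J -> J := fun=> d_x 4.
Definition bh_Y5 : J -> J := fun p =>
  let th := p.2 0 2 in let ph := p.2 0 3 in
  sin ph *: d_x 2 + (cos ph * cot th) *: d_x 3 - (cos ph * csc th) *: d_x 4.
Definition bh_Y6 : J -> J := fun p =>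
  let th := p.2 0 2 in let ph := p.2 0 3 in
  cos ph *: d_x 2 - (sin ph * cot th) *: d_x 3 + (sin ph * csc th) *: d_x 4.

End Generators.

(* Main.v *)
From HB Require Import structures.
Require Import Defs.
From mathcomp Require Import all_boot all_order all_algebra.
From mathcomp Require Import all_classical all_reals all_analysis.
From mathcomp Require Import ring.
Import Order.TTheory GRing.Theory Num.Theory.
Import numFieldNormedType.Exports.
Local Open Scope classical_set_scope.
Local Open Scope ring_scope.

(** For a vector field Y = xi d/ds + eta, the Noether condition is a polynomial
    identity of degree three in the velocity. Its cubic part says that xi depends
    on s alone; its quadratic part says that eta is, for each s, a homothety of
    the metric, L_eta g = lam g with lam = d xi/ds; its linear part says that
    2 g(d eta/ds, .) is the differential of the gauge function
    ([noether_equations]).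

    The metric is
      - a dt^2 + b dr^2 + h (dth^2 + sin^2 th dph^2) + w (dps + cos th dph)^2
    with a, b, h, w rational in r. The heart of the matter is that the radial
    component rho of eta vanishes ([radial_component_eq0]). With W = rho / r,
    f = F / r^4, k = K / G and n = F G^2, so that b = K^2 r^4 / n, the equations
    (rr), (r ps) and (ps ps) become
      2 r n W_r = lam n - (6 n - r n') W,
      8 K^2 r^4 W_psps = lam n - (6 n - r n') W,
    and cross-differentiating them leaves
      (r^2 n'' - 9 r n' + 24 n) W = lam (4 n - r n').
    The polynomial on the left is 24 n(0) = 24 q^2 rinf^8 at r = 0: because the
    charge is not zero it is a nonzero polynomial, so it vanishes at finitely
    many radii only. Differentiating in ps and in th gives W_ps = W_th = 0. Then
    W and d eta^th / dth do not depend on r, and (th th) is a polynomial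
    identity in r with these coefficients. It extends to all real r, and at
    r = rinf it says 4 rinf^2 W = 0. Finally (rr) gives lam = 0.

    Now all components of eta are independent of r, and each remaining equation
    has the shape P(r) F1 + Q(r) F2 = 0 with F1, F2 independent of r. Again it
    extends to all real r ([radial_extension]), and at r = 0 or r = rinf, outside
    the region, one of the two terms disappears. The equations thus decouple
    ([separate_base_time] and the lemmas after it): eta^t is constant, nothing
    depends on s or t, and on the angles there remains the system of the
    isometries of a round sphere, lifted to the circle bundle. There eta^th and
    Q = d eta^th / dph satisfy dQ/dph = - eta^th, and six explicit combinations
    of the components and of Q have zero derivative; as U is connected they are
    six constants, the coordinates of Y on the six generators
    ([symmetry_components]).

    Conversely every combination of the generators satisfies the Noether
    condition with zero gauge ([field_is_symmetry]). Hence the symmetries are the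
    fields that agree on the domain with such a combination, and the bracket of
    two combinations is again one ([bracket_field]). *)

Set Implicit Arguments.
Unset Strict Implicit.
Unset Printing Implicit Defensive.

(** * Differentiability and derivatives are local *)

Section Locality.
Context {R : realType} {V W : normedModType R}.
Implicit Types (A : set V) (F G : V -> W).

Lemma near_eq_on A F G p : open A -> A p -> (forall x, A x -> F x = G x) ->
  \near p, F p = G p.
Proof.
by move=> oA Ap FG; apply: filterS (open_nbhs_nbhs (conj oA Ap)) => x /FG.
Qed.

Lemma derive_eq_on A F G p v : open A -> A p -> (forall x, A x -> F x = G x) ->
  'D_v F p = 'D_v G p.
Proof. by move=> oA Ap FG; apply: near_eq_derive; exact: near_eq_on FG. Qed.

(** The differential of F also approximates G to first order, because the two
    functions have the same germ. *)
Lemma differentiable_eq_on A F G p : open A -> A p ->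
  (forall x, A x -> F x = G x) -> differentiable F p -> differentiable G p.
Proof.
move=> oA Ap FG dF.
have [cF eF] := (diff_locallyP _ _).1 dF.
have eG : G \o shift p = cst (G p) + 'd F p +o_ 0 id.
  apply/eqaddoP => e e0; have /eqaddoP/(_ e e0) := eF.
  have nFG : \forall x \near (0 : V), F (x + p) = G (x + p).
    have := near_eq_on oA Ap FG.
    by rewrite (near_shift 0) subr0.
  apply: filterS2 nFG => x /=.
  by rewrite /= (FG p Ap) !fctE /= => ->.
have dG := diff_unique cF eG.
apply/diff_locallyP; rewrite dG; split => //.
Qed.

End Locality.

(** * Smooth functions *)

Section SmoothOn.
Context {R : realType} {V : normedModType R}.
Variables (A : set V) (oA : open A).

Section Codomain.
Context {W : normedModType R}.
Implicit Types F G : V -> W.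

Lemma smooth_on_differentiable F p : smooth_on A F -> A p -> differentiable F p.
Proof. by move=> sF Ap; exact: (sF [::]). Qed.

Lemma smooth_on_derive F v : smooth_on A F -> smooth_on A (fun q => 'D_v F q).
Proof. by move=> sF l p Ap; have := sF (rcons l v) p Ap; rewrite foldr_rcons. Qed.

Lemma iter_derive_eq_on F G (l : seq V) : (forall x, A x -> F x = G x) ->
  forall x, A x -> foldr (fun v G q => 'D_v G q) F l x
                 = foldr (fun v G q => 'D_v G q) G l x.
Proof.
move=> FG; elim: l => [//|v l IH] x Ax /=.
exact: derive_eq_on oA Ax IH.
Qed.

(** Smoothness quantifies over all iterated derivatives, so it is proved by
    coinduction: it is enough to find a class of differentiable functions that
    is stable under directional derivatives, up to equality on A. *)
Lemma smooth_on_coind (P : set (V -> W)) :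
  (forall F, P F -> (forall p, A p -> differentiable F p) /\
    forall v, exists2 G, P G & forall p, A p -> 'D_v F p = G p) ->
  forall F, P F -> smooth_on A F.
Proof.
move=> step F PF l; elim/last_ind: l F PF => [|l v IH] F PF p Ap.
  by have [dF _] := step F PF; exact: dF.
have [_ /(_ v)[G PG DG]] := step F PF.
rewrite foldr_rcons.
apply: (differentiable_eq_on oA Ap _ (IH _ PG p Ap)) => x Ax.
by apply: iter_derive_eq_on => // y Ay; rewrite DG.
Qed.

Lemma smooth_on_eq F G : (forall x, A x -> F x = G x) ->
  smooth_on A F -> smooth_on A G.
Proof.
move=> FG sF l p Ap.
by apply: (differentiable_eq_on oA Ap _ (sF l p Ap)); exact: iter_derive_eq_on.
Qed.

Lemma smooth_on_cst (w : W) : smooth_on A (fun=> w).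
Proof.
apply: (@smooth_on_coind [set F | exists w, F = cst w]); last by exists w.
move=> _ [{}w ->]; split=> [p _|v]; first exact: differentiable_cst.
exists (cst 0); first by exists 0.
by move=> p _; rewrite derive_cst.
Qed.

Lemma smooth_onD F G : smooth_on A F -> smooth_on A G ->
  smooth_on A (fun p => F p + G p).
Proof.
move=> sF sG; apply: (@smooth_on_coind
  [set H | exists F G, [/\ smooth_on A F, smooth_on A G & H = F + G]]); last first.
  by exists F, G.
move=> _ [{sG}F [{sF}G [sF sG ->]]].
have dF p := @smooth_on_differentiable F p sF.
have dG p := @smooth_on_differentiable G p sG.
split=> [p Ap|v]; first by apply: differentiableD; [exact: dF|exact: dG].
exists ((fun q => 'D_v F q) + (fun q => 'D_v G q)).
  by exists (fun q => 'D_v F q), (fun q => 'D_v G q); split=> //;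
    exact: smooth_on_derive.
move=> p Ap; rewrite deriveD//; apply: diff_derivable; [exact: dF|exact: dG].
Qed.

Lemma smooth_on_sum n (F : 'I_n -> V -> W) : (forall i, smooth_on A (F i)) ->
  smooth_on A (fun p => \sum_(i < n) F i p).
Proof.
move=> sF; elim: n F sF => [|n IH] F sF.
  apply: smooth_on_eq (smooth_on_cst 0) => x _ /=; by rewrite big_ord0.
apply: smooth_on_eq (smooth_onD (IH _ (fun i => sF (widen_ord (leqnSn n) i))) (sF ord_max)).
by move=> x _ /=; rewrite big_ord_recr.
Qed.

End Codomain.

(** Coordinates of derivatives are derivatives of coordinates. *)
Lemma is_derive_linear_comp {W W' : normedModType R} (L : {linear W -> W'})
    (F : V -> W) p v : continuous L -> differentiable F p ->
  is_derive p v (fun x => L (F x)) (L ('D_v F p)).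
Proof.
move=> cL dF; have dL : differentiable L (F p) by exact: linear_differentiable.
have dLF : differentiable (L \o F) p by exact: differentiable_comp.
apply: DeriveDef; first exact: diff_derivable.
by rewrite -[fun x => _]/(L \o F) deriveE// diff_comp// diff_lin// deriveE.
Qed.

Lemma smooth_on_linear {W W' : normedModType R} (L : {linear W -> W'})
    (F : V -> W) : continuous L -> smooth_on A F ->
  smooth_on A (fun p => L (F p)).
Proof.
move=> cL sF; apply: (@smooth_on_coind _
  [set G | exists2 F : V -> W, smooth_on A F & G = L \o F]); last by exists F.
move=> _ [{sF}F sF ->]; have dF p := @smooth_on_differentiable _ F p sF.
split=> [p Ap|v].
  by apply: differentiable_comp; [exact: dF|exact: linear_differentiable].
exists (L \o (fun q => 'D_v F q)).
  by exists (fun q => 'D_v F q) => //; exact: smooth_on_derive.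
move=> p Ap /=; have dL := is_derive_linear_comp v cL (dF p Ap).
exact: derive_val.
Qed.

Lemma smooth_on_id : smooth_on A (@id V).
Proof.
apply: (@smooth_on_coind _ [set F | F = id \/ exists w, F = cst w]); last by left.
move=> _ [->|[w ->]]; split=> [p _|v].
- exact: (@ex_diff _ _ _ _ _ _ _ (is_diff_id p)).
- exists (cst v); first by right; exists v.
  by move=> p _; rewrite derive_id.
- exact: differentiable_cst.
- exists (cst 0); first by right; exists 0.
  by move=> p _; rewrite derive_cst.
Qed.

End SmoothOn.

Section ScalarRules.
Context {R : realType} {V : normedModType R}.
Implicit Types (f g : V -> R) (p v : V).

Lemma is_derive_add f g p v df dg : is_derive p v f df -> is_derive p v g dg ->
  is_derive p v (fun x => f x + g x) (df + dg).
Proof. exact: is_deriveD. Qed.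

Lemma is_derive_opp f p v df : is_derive p v f df ->
  is_derive p v (fun x => - f x) (- df).
Proof. exact: is_deriveN. Qed.

Lemma is_derive_mul f g p v df dg : is_derive p v f df -> is_derive p v g dg ->
  is_derive p v (fun x => f x * g x) (df * g p + f p * dg).
Proof.
move=> dF dG; apply: is_derive_eq (is_deriveM dF dG) _.
by rewrite addrC mulrC.
Qed.

Lemma is_derive_const (c : R) p v : is_derive p v (fun=> c) 0.
Proof. exact: is_derive_cst. Qed.

Lemma is_derive_chain (phi : R -> R) f p v dphi df :
  is_derive (f p) 1 phi dphi -> differentiable f p -> is_derive p v f df ->
  is_derive p v (fun x => phi (f x)) (dphi * df).
Proof.
move=> dP diff [_ <-].
have dp : differentiable phi (f p).
  by apply/derivable1_diffP; exact: (@ex_derive _ _ _ _ _ _ _ dP).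
have dc : differentiable (phi \o f) p by exact: differentiable_comp.
apply: DeriveDef; first exact: diff_derivable.
rewrite -[fun x => _]/(phi \o f) deriveE// diff_comp// deriveE//=.
rewrite -[X in 'd phi _ X]mulr1 [LHS]linearZ/=.
have -> : 'd phi (f p) 1 = dphi by rewrite -deriveE//; exact: derive_val.
by rewrite -[LHS]/(_ * _) mulrC.
Qed.

Lemma is_derive_inv f p v df : f p != 0 -> is_derive p v f df ->
  is_derive p v (fun x => (f x)^-1) (- (df * ((f p)^-1 * (f p)^-1))).
Proof.
move=> f0 [ef <-]; apply: DeriveDef; first exact: derivableV.
rewrite deriveV// -[_ *: _]/(_ * _) -exprVn expr2; ring.
Qed.

End ScalarRules.

Section SmoothScalar.
Context {R : realType} {V : normedModType R}.
Variables (A : set V) (oA : open A).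
Implicit Types f g : V -> R.

(** The class to which [smooth_on_coind] is applied to obtain the closure of
    scalar smooth functions under products, sine, cosine and inverse in one
    go. *)
Inductive elementary : (V -> R) -> Prop :=
| elem_smooth f of smooth_on A f : elementary f
| elem_add f g of elementary f & elementary g : elementary (fun p => f p + g p)
| elem_mul f g of elementary f & elementary g : elementary (fun p => f p * g p)
| elem_sin f of elementary f : elementary (fun p => sin (f p))
| elem_cos f of elementary f : elementary (fun p => cos (f p))
| elem_inv f of elementary f & (forall p, A p -> f p != 0) :
    elementary (fun p => (f p)^-1).

Lemma elementary_derive f : elementary f ->
  (forall p, A p -> differentiable f p) /\
  forall v, exists2 g, elementary g & forall p, A p -> 'D_v f p = g p.
Proof.
elim=> {f}.
- move=> f sf; split=> [p Ap|v]; first exact: smooth_on_differentiable sf Ap.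
  exists (fun q => 'D_v f q) => //; apply: elem_smooth.
  exact: smooth_on_derive.
- move=> f g ef [df Df] eg [dg Dg]; split=> [p Ap|v].
    by apply: differentiableD; [exact: df|exact: dg].
  have [f' ef' Df'] := Df v; have [g' eg' Dg'] := Dg v.
  exists (fun p => f' p + g' p); first exact: elem_add.
  move=> p Ap; rewrite -Df'// -Dg'//; apply: derive_val.
  by apply: is_derive_add; apply/derivableP/diff_derivable; [exact: df|exact: dg].
- move=> f g ef [df Df] eg [dg Dg]; split=> [p Ap|v].
    by apply: differentiableM; [exact: df|exact: dg].
  have [f' ef' Df'] := Df v; have [g' eg' Dg'] := Dg v.
  exists (fun p => f' p * g p + f p * g' p).
    by apply: elem_add; exact: elem_mul.
  move=> p Ap; rewrite -Df'// -Dg'//; apply: derive_val.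
  by apply: is_derive_mul; apply/derivableP/diff_derivable; [exact: df|exact: dg].
- move=> f ef [df Df]; split=> [p Ap|v].
    apply: (@differentiable_comp _ _ _ _ f sin); first exact: df.
    exact/derivable1_diffP/derivable_sin.
  have [f' ef' Df'] := Df v; exists (fun p => cos (f p) * f' p).
    by apply: elem_mul => //; exact: elem_cos.
  move=> p Ap; rewrite -Df'//; apply: derive_val.
  apply: is_derive_chain; first exact: df.
  by apply/derivableP/diff_derivable; exact: df.
- move=> f ef [df Df]; split=> [p Ap|v].
    apply: (@differentiable_comp _ _ _ _ f cos); first exact: df.
    exact/derivable1_diffP/derivable_cos.
  have [f' ef' Df'] := Df v; exists (fun p => (-1) * sin (f p) * f' p).
    apply: elem_mul => //; apply: elem_mul; last exact: elem_sin.
    by apply: elem_smooth; exact: smooth_on_cst.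
  move=> p Ap; rewrite -Df'// mulN1r; apply: derive_val.
  apply: is_derive_chain; first exact: df.
  by apply/derivableP/diff_derivable; exact: df.
- move=> f ef [df Df] f0; split=> [p Ap|v].
    by apply: differentiableV; [exact: df|exact: f0].
  have [f' ef' Df'] := Df v.
  exists (fun p => (-1) * (f' p * ((f p)^-1 * (f p)^-1))).
    apply: elem_mul; first by apply: elem_smooth; exact: smooth_on_cst.
    by apply: elem_mul => //; apply: elem_mul; exact: elem_inv.
  move=> p Ap; rewrite -Df'// mulN1r; apply: derive_val.
  apply: is_derive_inv; first exact: f0.
  by apply/derivableP/diff_derivable; exact: df.
Qed.

Lemma elementary_smooth f : elementary f -> smooth_on A f.
Proof. exact: smooth_on_coind elementary_derive f. Qed.

Lemma smooth_onM f g : smooth_on A f -> smooth_on A g ->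
  smooth_on A (fun p => f p * g p).
Proof.
by move=> sf sg; apply: elementary_smooth; apply: elem_mul; exact: elem_smooth.
Qed.

End SmoothScalar.

(** * Symmetry of second derivatives, constancy, polynomials along a line *)

Section Lines.
Context {R : realType} {V : normedModType R}.
Implicit Types (F : V -> R) (p v w : V).

Lemma is_derive_line F p v t : differentiable F (p + t *: v) ->
  is_derive t 1 (fun t : R => F (p + t *: v)) ('D_v F (p + t *: v)).
Proof.
move=> dF; have dv : derivable F (p + t *: v) v by exact: diff_derivable.
have e : (fun h : R => h^-1 *: (((fun t : R => F (p + t *: v)) \o shift t) (h *: 1)
    - F (p + t *: v)))
  = (fun h : R => h^-1 *: ((F \o shift (p + t *: v)) (h *: v) - F (p + t *: v))).
  apply/funext => h /=; congr (_ *: (F _ - _)).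
  by rewrite -[h *: 1]/(h * 1) mulr1 scalerDl addrCA.
by apply: DeriveDef; rewrite /derivable/derive e.
Qed.

Lemma mvt0 (g dg : R -> R) (h : R) : 0 < h ->
  (forall t, 0 <= t <= h -> is_derive t 1 g (dg t)) ->
  exists2 c, 0 < c < h & g h - g 0 = h * dg c.
Proof.
move=> h0 dgP; have [||c] := @MVT R g dg 0 h h0.
- by move=> x; rewrite in_itv/= => /andP[x0 xh]; apply: dgP; rewrite !ltW.
- apply: derivable_within_continuous => x; rewrite in_itv/= => xh.
  by have [] := dgP x xh.
by rewrite in_itv/= subr0 mulrC => ch ->; exists c.
Qed.

Lemma mvt_line F p v (h : R) : 0 < h ->
  (forall t, 0 <= t <= h -> differentiable F (p + t *: v)) ->
  exists2 c, 0 < c < h & F (p + h *: v) - F p = h * 'D_v F (p + c *: v).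
Proof.
move=> h0 dF.
have [t th|c ch] := @mvt0 (fun t => F (p + t *: v)) (fun t => 'D_v F (p + t *: v)) h h0.
  exact/is_derive_line/dF.
by move=> E; exists c => //; rewrite -[RHS]E scale0r addr0.
Qed.

(** The second difference of F over a parallelogram equals the mixed second
    derivative at an interior point: the mean value theorem is applied to the
    difference of F over the side w, along v, and then to 'D_v F along w. *)
Lemma mvt_mixed (A : set V) F p v w (h : R) : 0 < h -> smooth_on A F ->
  (forall a b, 0 <= a <= h -> 0 <= b <= h -> A (p + a *: v + b *: w)) ->
  exists2 ab : R * R, 0 < ab.1 < h /\ 0 < ab.2 < h &
    F (p + h *: v + h *: w) - F (p + h *: v) - (F (p + h *: w) - F p)
      = h ^+ 2 * 'D_w (fun q => 'D_v F q) (p + ab.1 *: v + ab.2 *: w).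
Proof.
move=> h0 sF AF.
have hh : 0 <= h <= h by rewrite ltW//=.
have z0 : (0 : R) <= 0 <= h by rewrite lexx ltW.
pose g t := F (p + h *: w + t *: v) - F (p + t *: v).
pose dg t := 'D_v F (p + h *: w + t *: v) - 'D_v F (p + t *: v).
have [t th|a ah] := @mvt0 g dg h h0.
  apply: is_derive_add.
    apply: is_derive_line; apply: (smooth_on_differentiable sF).
    by rewrite addrAC; exact: AF.
  apply: is_derive_opp; apply: is_derive_line; apply: (smooth_on_differentiable sF).
  by have := AF t 0 th z0; rewrite scale0r addr0.
rewrite /g /dg !scale0r !addr0 (addrAC p) => ->.
have [a0 /ltW aleh] := andP ah; have ah' : 0 <= a <= h by rewrite ltW.
have [t th|b bh] := @mvt_line (fun q => 'D_v F q) (p + a *: v) w h h0.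
  by apply: (smooth_on_differentiable (smooth_on_derive v sF)); exact: AF.
by rewrite (addrAC p) => ->; exists (a, b) => //=; rewrite mulrA expr2.
Qed.

(** Two continuous functions agree at p when each neighbourhood of p holds a
    value that they share, even if they take it at different points. This is
    the limit step in the symmetry of second derivatives. *)
Lemma eq_of_small_boxes (A : set V) (H1 H2 : V -> R) p v w : open A -> A p ->
  {for p, continuous H1} -> {for p, continuous H2} ->
  (forall h : R, 0 < h ->
    (forall a b, 0 <= a <= h -> 0 <= b <= h -> A (p + a *: v + b *: w)) ->
    exists a1 b1 a2 b2, [/\ 0 <= a1 <= h, 0 <= b1 <= h, 0 <= a2 <= h, 0 <= b2 <= h &
      H1 (p + a1 *: v + b1 *: w) = H2 (p + a2 *: v + b2 *: w)]) ->
  H1 p = H2 p.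
Proof.
move=> oA Ap c1 c2 meet.
suff close e : 0 < e -> `|H1 p - H2 p| <= e + e.
  apply/eqP; rewrite -subr_eq0 -normr_le0; apply/ler_addgt0Pr => e e0.
  by rewrite add0r [e]splitr close// divr_gt0.
move=> e0.
have : \forall q \near p, [/\ A q, `|H1 p - H1 q| < e & `|H2 p - H2 q| < e].
  near=> q; split.
  - by near: q; exact: open_nbhs_nbhs.
  - by near: q; move/cvgrPdist_lt : c1; apply.
  - by near: q; move/cvgrPdist_lt : c2; apply.
move=> /nbhs_normP[d /= d0 dP].
have N0 : 0 < `|v| + `|w| + 1 by rewrite ltr_wpDl// addr_ge0.
set h := d / (`|v| + `|w| + 1).
have h0 : 0 < h by rewrite divr_gt0.
have inball a b : 0 <= a <= h -> 0 <= b <= h ->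
    [/\ A (p + a *: v + b *: w), `|H1 p - H1 (p + a *: v + b *: w)| < e &
       `|H2 p - H2 (p + a *: v + b *: w)| < e].
  move=> /andP[a0 ah] /andP[b0 bh]; apply: dP => /=.
  rewrite -addrA opprD addNKr normrN.
  apply: le_lt_trans (ler_normD _ _) _; rewrite !normrZ !ger0_norm//.
  apply: (@le_lt_trans _ _ (h * (`|v| + `|w|))).
    by rewrite mulrDr lerD// ler_wpM2r.
  by rewrite /h mulrAC ltr_pdivrMr// ltr_pM2l// ltrDl.
have [a b ah bh|a1 [b1 [a2 [b2 [a1h b1h a2h b2h E]]]]] := meet h h0.
  by have [] := inball a b ah bh.
have [_ L1 _] := inball a1 b1 a1h b1h.
have [_ _ L2] := inball a2 b2 a2h b2h.
rewrite -(subrKA (H1 (p + a1 *: v + b1 *: w))) {2}E.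
apply: le_trans (ler_normD _ _) _; apply: lerD; first exact: ltW.
by rewrite distrC ltW.
Unshelve. all: by end_near. Qed.

(** Up to exchanging v and w, the second difference of F is the same, so by
    [mvt_mixed] the two mixed derivatives share a value in each small
    parallelogram at p. *)
Theorem schwarz (A : set V) F p v w : open A -> smooth_on A F -> A p ->
  'D_w (fun q => 'D_v F q) p = 'D_v (fun q => 'D_w F q) p.
Proof.
move=> oA sF Ap.
have s1 := smooth_on_derive w (smooth_on_derive v sF).
have s2 := smooth_on_derive v (smooth_on_derive w sF).
apply: (eq_of_small_boxes (v := v) (w := w) oA Ap
  (differentiable_continuous (smooth_on_differentiable s1 Ap))
  (differentiable_continuous (smooth_on_differentiable s2 Ap))) => h h0 box.
have wk c : 0 < c < h -> 0 <= c <= h by move=> /andP[/ltW -> /ltW ->].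
have [[a1 b1] /= [a1h b1h] E1] := @mvt_mixed A F p v w h h0 sF box.
have [a b ah bh|[b2 a2] /= [b2h a2h] E2] := @mvt_mixed A F p w v h h0 sF.
  by rewrite addrAC; exact: box.
exists a1, b1, a2, b2; split; try exact: wk.
apply: (mulfI (lt0r_neq0 (exprn_gt0 2 h0))).
rewrite -[LHS]E1 (addrAC p (a2 *: v)) -[RHS]E2 (addrAC p (h *: w)).
move: (F _) (F _) (F _) (F _) => x y z t; ring.
Qed.

Lemma near_line (A : set V) p v : open A -> A p ->
  exists2 d : R, 0 < d & forall t, `|t| <= d -> A (p + t *: v).
Proof.
move=> oA Ap; have /nbhs_normP[d /= d0 dP] := open_nbhs_nbhs (conj oA Ap).
have N0 : 0 < `|v| + 1 by rewrite ltr_wpDl.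
exists (d / (`|v| + 1)); first by rewrite divr_gt0.
move=> t td; apply: dP; rewrite /= opprD addNKr normrN normrZ.
apply: (@le_lt_trans _ _ (d / (`|v| + 1) * `|v|)); first by rewrite ler_wpM2r.
by rewrite mulrAC ltr_pdivrMr// ltr_pM2l// ltrDl.
Qed.

(** Only a one-sided segment is needed to produce infinitely many roots in
    [poly_eq0_near]. *)
Lemma constant_along (A : set V) F p v : open A -> A p ->
  (forall q, A q -> differentiable F q) -> (forall q, A q -> 'D_v F q = 0) ->
  exists2 d : R, 0 < d & forall t, 0 <= t <= d ->
    A (p + t *: v) /\ F (p + t *: v) = F p.
Proof.
move=> oA Ap dF DF; have [d d0 dP] := near_line v oA Ap.
exists d => // t /andP[t0 td]; split; first by apply: dP; rewrite ger0_norm.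
move: t0; rewrite le_eqVlt => /predU1P[<-|t0]; first by rewrite scale0r addr0.
have inA s : 0 <= s <= t -> A (p + s *: v).
  by move=> /andP[s0 st]; apply: dP; rewrite ger0_norm// (le_trans st).
have [s st|c /andP[c0 ct]] := @mvt_line F p v t t0; first exact/dF/inA.
by rewrite DF ?mulr0 => [/eqP|]; [rewrite subr_eq0 => /eqP|apply: inA; rewrite !ltW].
Qed.

Lemma locally_constant (A : set V) F p : open A -> A p ->
  (forall q, A q -> differentiable F q) ->
  (forall q v, A q -> 'D_v F q = 0) -> \forall q \near p, F q = F p.
Proof.
move=> oA Ap dF DF; have /nbhs_normP[d /= d0 dP] := open_nbhs_nbhs (conj oA Ap).
apply/nbhs_normP; exists d => //= q pq.
have inA s : 0 <= s <= 1 -> A (p + s *: (q - p)).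
  move=> /andP[s0 s1]; apply: dP; rewrite /= opprD addNKr normrN normrZ.
  by rewrite distrC ger0_norm// (le_lt_trans _ pq)// ler_piMl.
have [s st|c /andP[c0 ct]] := @mvt_line F p (q - p) 1 ltr01; first exact/dF/inA.
rewrite scale1r (addrC p (q - p)) subrK DF ?mulr0 => [/eqP|].
  by rewrite subr_eq0 => /eqP.
by apply: inA; rewrite !ltW.
Qed.

End Lines.

(** The set where f takes a given value and its complement in U are open. *)
Lemma connected_locally_constant {T : topologicalType} {X : Type} (U : set T)
    (f : T -> X) : open U -> connected U ->
  (forall x, U x -> \forall y \near x, f y = f x) ->
  forall x y, U x -> U y -> f x = f y.
Proof.
move=> oU cU fl x y Ux Uy.
have opn (P : set X) : open (U `&` [set z | P (f z)]).
  rewrite openE => z [Uz Pz]; rewrite /interior/=.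
  apply: filterS2 (open_nbhs_nbhs (conj oU Uz)) (fl z Uz) => t Ut /= ftz.
  by split => //=; rewrite ftz.
suff : U `&` [set z | f x = f z] = U by move/seteqP => [_ /(_ y Uy)[]].
apply: cU; first by exists x.
- by exists (U `&` [set z | f x = f z]); [exact: (opn (fun a => f x = a))|rewrite setIA setIid].
- exists (~` (U `&` [set z | f x <> f z])).
    by apply: open_closedC; exact: (opn (fun a => f x <> a)).
  apply/seteqP; split=> z /= [Uz H]; split=> //; first by move=> [_].
  by apply: contrapT => ne; apply: H.
Qed.

(** The points x + d / (k + 1) are roots, more of them than the degree
    allows. *)
Lemma poly_eq0_near {R : realType} (P : {poly R}) (x d : R) : 0 < d ->
  (forall t, 0 <= t <= d -> P.[x + t] = 0) -> P = 0.
Proof.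
move=> d0 P0; apply/eqP; apply: contraT => Pn0.
pose rs := [seq x + d / k.+1%:R | k <- iota 0 (size P)].
have := @max_poly_roots _ P rs Pn0; rewrite size_map size_iota ltnn; apply.
- apply/allP => _ /mapP[k _ ->]; rewrite rootE P0//.
  apply/andP; split; first by rewrite divr_ge0// ltW.
  by rewrite ler_pdivrMr// ler_peMr ?ler1n// ltW.
- rewrite map_inj_uniq ?iota_uniq// => i j /addrI /(mulfI (lt0r_neq0 d0)).
  by move=> /invr_inj /eqP; rewrite eqr_nat => /eqP[].
Qed.

Section PolynomialsAlongALine.
Context {R : realType} {V : normedModType R}.
Variables (A : set V) (oA : open A) (rho : V -> R) (e : V).
(** The function rho plays the role of the radial coordinate, and e that of the
    radial vector: rho increases at unit speed along e. *)
Hypothesis rhoE : forall p t, rho (p + t *: e) = rho p + t.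

(** Along the line through p the functions F and G are constant, so the
    polynomial F(p) a + G(p) b vanishes on an interval and is the zero
    polynomial. Its value may then be used at radii outside the region. *)
Lemma radial_extension (F G : V -> R) (a b : {poly R}) :
  (forall p, A p -> differentiable F p) -> (forall p, A p -> 'D_e F p = 0) ->
  (forall p, A p -> differentiable G p) -> (forall p, A p -> 'D_e G p = 0) ->
  (forall p, A p -> F p * a.[rho p] + G p * b.[rho p] = 0) ->
  forall p x, A p -> F p * a.[x] + G p * b.[x] = 0.
Proof.
move=> dF DF dG DG FG p x Ap.
have [d d0 Fc] := constant_along oA Ap dF DF.
have [d' d'0 Gc] := constant_along oA Ap dG DG.
have m0 : 0 < Num.min d d' by rewrite lt_min d0.
have /(congr1 (fun P => P.[x])) : F p *: a + G p *: b = 0.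
  apply: (@poly_eq0_near _ _ (rho p) _ m0) => t /andP[t0]; rewrite le_min => /andP[td td'].
  have [At Ft] := Fc t (introT andP (conj t0 td)).
  have [_ Gt] := Gc t (introT andP (conj t0 td')).
  by rewrite !hornerE -rhoE -Ft -Gt; exact: FG.
by rewrite !hornerE.
Qed.

(** If F(p) were nonzero, F would be nonzero near p and the polynomial a would
    vanish on an interval. *)
Lemma poly_mul_eq0 (F : V -> R) (a : {poly R}) : a != 0 ->
  (forall p, A p -> {for p, continuous F}) ->
  (forall p, A p -> a.[rho p] * F p = 0) -> forall p, A p -> F p = 0.
Proof.
move=> a0 cF aF p Ap; apply/eqP; apply: contraNT a0 => Fp; apply/eqP.
have nF : nbhs p (A `&` [set q | F q != 0]).
  apply: filterI; first exact: open_nbhs_nbhs.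
  have := cF p Ap; move=> /cvgrPdist_lt/(_ `|F p|).
  rewrite normr_gt0 => /(_ Fp); apply: filterS => q /=.
  by apply: contraTneq => ->; rewrite subr0 ltxx.
have [d d0 dP] := near_line e (@open_interior _ _) nF.
apply: (@poly_eq0_near _ _ (rho p) _ d0) => t /andP[t0 td].
have [|Aq Fq] := interior_subset (dP t _); first by rewrite ger0_norm.
have /eqP := aF _ Aq; rewrite mulf_eq0 (negbTE Fq) orbF rhoE.
by move/eqP.
Qed.

End PolynomialsAlongALine.

Section Strip.
Context {R : realType}.
Local Notation X := 'rV[R]_5.
Local Notation J := (R * 'rV[R]_5)%type.

Lemma entry_linear (i : 'I_5) : linear (fun x : X => x 0 i).
Proof. by move=> a x y; rewrite !mxE. Qed.

Definition entry (i : 'I_5) : {linear X -> R} :=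
  HB.pack (fun x : X => x 0 i) (GRing.isLinear.Build _ _ _ _ _ (entry_linear i)).

Lemma entry_continuous i : continuous (entry i).
Proof. exact: coord_continuous. Qed.

Lemma snd_continuous : continuous (snd : J -> X).
Proof. by move=> p; exact: cvg_snd. Qed.

Lemma fst_continuous : continuous (fst : J -> R).
Proof. by move=> p; exact: cvg_fst. Qed.

Lemma derive_coords (F : J -> R) p v : differentiable F p ->
  'D_v F p = v.1 * 'D_d_s F p + \sum_(i < 5) v.2 0 i * 'D_(d_x i) F p.
Proof.
move=> dF; rewrite !deriveE//.
have {1}-> : v = v.1 *: d_s + \sum_(i < 5) v.2 0 i *: d_x i.
  case: v => s x; apply/pair_equal_spec; split=> /=.
    rewrite (raddf_sum fst)/= big1 ?addr0 => [|i _]; last by rewrite scaler0.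
    by rewrite -[s *: 1]/(s * 1) mulr1.
  rewrite (raddf_sum snd)/= scaler0 add0r [LHS]row_sum_delta//.
rewrite linearD linearZ/= linear_sum; congr (_ + _).
by apply: eq_bigr => i _; rewrite deriveE// linearZ.
Qed.

Variables (U : set X) (oU : open U).
Local Notation D := (setT `*` U : set J).

Lemma open_strip : open D.
Proof.
have -> : D = snd @^-1` U by apply/seteqP; split=> [p []|p].
by apply: open_comp => // p _; exact: snd_continuous.
Qed.

(** In the s direction the mean value theorem applies on the whole line; in the
    x directions F is locally constant and U is connected. *)
Lemma constant_on_strip (F : J -> R) : connected U ->
  (forall p, D p -> differentiable F p) ->
  (forall p, D p -> 'D_d_s F p = 0) ->
  (forall p i, D p -> 'D_(d_x i) F p = 0) ->
  forall p q, D p -> D q -> F p = F q.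
Proof.
move=> cU dF Ds Dx.
have DF p v : D p -> 'D_v F p = 0.
  move=> Dp; rewrite derive_coords ?Ds// ?mulr0 ?add0r; last exact: dF.
  by rewrite big1// => i _; rewrite Dx// mulr0.
have along_s s x : U x -> F (s, x) = F (0, x).
  move=> Ux; have lineE t : (0, x) + t *: d_s = (t, x) :> J.
    apply/pair_equal_spec; split=> /=; last by rewrite scaler0 addr0.
    by rewrite add0r -[t *: 1]/(t * 1) mulr1.
  have := @is_derive_0_is_cst R (fun t => F ((0, x) + t *: d_s)) s 0.
  rewrite !lineE; apply => t.
  have Dt : D ((0, x) + t *: d_s) by rewrite lineE.
  by have := is_derive_line (dF _ Dt); rewrite Ds.
move=> [s x] [s' x'] [_ /= Ux] [_ /= Ux']; rewrite along_s// [RHS]along_s//.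
apply: (@connected_locally_constant _ _ U (fun y => F (0, y))) => // y Uy.
have nF := @locally_constant _ _ D F (0, y) open_strip (conj I Uy) dF DF.
have [[P Q] /= [P0 Qy] PQ] := nF.
apply: filterS Qy => z Qz.
exact: (PQ (0, z) (conj (nbhs_singleton P0) Qz)).
Qed.

End Strip.

(** * The Noether condition as a first order system *)

Lemma ord5_ind (P : 'I_5 -> Prop) :
  P 0 -> P 1 -> P 2 -> P 3 -> P 4 -> forall i, P i.
Proof.
move=> P0 P1 P2 P3 P4 [[|[|[|[|[|//]]]]] i5].
- by rewrite (_ : Ordinal i5 = 0)//; apply/val_inj.
- by rewrite (_ : Ordinal i5 = 1)//; apply/val_inj.
- by rewrite (_ : Ordinal i5 = 2)//; apply/val_inj.
- by rewrite (_ : Ordinal i5 = 3)//; apply/val_inj.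
- by rewrite (_ : Ordinal i5 = 4)//; apply/val_inj.
Qed.

Section CoordinateRules.
Context {R : realType}.
Local Notation X := 'rV[R]_5.
Local Notation J := (R * 'rV[R]_5)%type.

Lemma sum5 (F : 'I_5 -> R) :
  \sum_(i < 5) F i = F 0 + F 1 + F 2 + F 3 + F 4.
Proof.
rewrite !big_ord_recl big_ord0 addr0 !addrA.
by do ! congr (_ + _); congr F; apply/val_inj.
Qed.

Lemma d_x_entry (nu i : 'I_5) : (@d_x R nu).2 0 i = (i == nu)%:R.
Proof. by rewrite /= mxE eqxx. Qed.

Lemma is_derive_linear {V W : normedModType R} (L : {linear V -> W}) p v :
  continuous L -> is_derive p v L (L v).
Proof.
move=> cL; have dL : differentiable L p by exact: linear_differentiable.
by apply: DeriveDef; [exact: diff_derivable|rewrite deriveE// diff_lin].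
Qed.

Lemma differentiable_entry (i : 'I_5) (p : J) :
  differentiable (fun q : J => q.2 0 i) p.
Proof.
apply: (@differentiable_comp _ _ _ _ (snd : J -> X) (fun x : X => x 0 i)).
  exact/linear_differentiable/snd_continuous.
exact: differentiable_coord.
Qed.

Lemma is_derive_entry (i : 'I_5) (p v : J) :
  is_derive p v (fun q : J => q.2 0 i) (v.2 0 i).
Proof.
apply: (@is_derive_linear _ _ (entry i \o snd)) => q.
by apply: continuous_comp; [exact: snd_continuous|exact: entry_continuous].
Qed.

Lemma is_derive_velocity (i : 'I_5) (x v : X) :
  is_derive x v (fun y : X => y 0 i) (v 0 i).
Proof. exact: (@is_derive_linear _ _ (entry i) _ _ (@entry_continuous R i)). Qed.

Lemma is_derive_entry_comp (phi : R -> R) (i : 'I_5) (p v : J) (dphi : R) :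
  is_derive (p.2 0 i) 1 phi dphi ->
  is_derive p v (fun q : J => phi (q.2 0 i)) (dphi * v.2 0 i).
Proof.
move=> dP; apply: is_derive_chain; first exact: differentiable_entry.
exact: is_derive_entry.
Qed.

Lemma is_derive_sqr {V : normedModType R} (f : V -> R) p v df :
  is_derive p v f df -> is_derive p v (fun x => f x ^+ 2) (2 * f p * df).
Proof.
move=> dF; apply: is_derive_eq (is_derive_mul dF dF) _.
ring.
Qed.

End CoordinateRules.

Section Lagrangian.
Context {R : realType}.
Local Notation X := 'rV[R]_5.
Local Notation J := (R * 'rV[R]_5)%type.
Variables a b h w : R -> R.

(** The circle-bundle form of the geodesic Lagrangian, with the four metric
    coefficients left arbitrary. *)
Definition lag (p : J) (v : X) : R :=
  let r := p.2 0 1 in let th := p.2 0 2 in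
  - a r * v 0 0 ^+ 2 + b r * v 0 1 ^+ 2
  + h r * (v 0 2 ^+ 2 + sin th ^+ 2 * v 0 3 ^+ 2)
  + w r * (v 0 4 + cos th * v 0 3) ^+ 2.

Definition lag_metric (p : J) (v u : X) : R :=
  let r := p.2 0 1 in let th := p.2 0 2 in
  - a r * v 0 0 * u 0 0 + b r * v 0 1 * u 0 1
  + h r * (v 0 2 * u 0 2 + sin th ^+ 2 * v 0 3 * u 0 3)
  + w r * (v 0 4 + cos th * v 0 3) * (u 0 4 + cos th * u 0 3).

(** The derivative of [lag] in th; [lag_r] below is the one in r. *)
Definition lag_th (p : J) (v : X) : R :=
  let r := p.2 0 1 in let th := p.2 0 2 in
  2 * h r * sin th * cos th * v 0 3 ^+ 2
  - 2 * w r * sin th * (v 0 4 + cos th * v 0 3) * v 0 3.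

Variables (p : J) (a' b' h' w' : R).
Hypotheses (da : is_derive (p.2 0 1) 1 a a') (db : is_derive (p.2 0 1) 1 b b')
  (dh : is_derive (p.2 0 1) 1 h h') (dw : is_derive (p.2 0 1) 1 w w').

Definition lag_r (v : X) : R :=
  let th := p.2 0 2 in
  - a' * v 0 0 ^+ 2 + b' * v 0 1 ^+ 2
  + h' * (v 0 2 ^+ 2 + sin th ^+ 2 * v 0 3 ^+ 2)
  + w' * (v 0 4 + cos th * v 0 3) ^+ 2.

(* Computes the derivative of an expression built from coordinates, velocities
   and the four coefficients. *)
Ltac isd_lag := repeat first
  [ eapply is_derive_add | eapply is_derive_mul | eapply is_derive_opp
  | eapply is_derive_const
  | eapply is_derive_entry_comp; eassumption
  | eapply is_derive_sqr
  | eapply is_derive_entry_comp; first [eapply is_derive_sin | eapply is_derive_cos]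
  | eapply is_derive_velocity ].

Lemma derive_lag_pos (e : J) (v : X) :
  'D_e (fun q => lag q v) p = lag_r v * e.2 0 1 + lag_th p v * e.2 0 2.
Proof.
apply: derive_val; apply: is_derive_eq.
  rewrite /lag; isd_lag.
rewrite /lag_r /lag_th /=; ring.
Qed.

Lemma derive_lag_vel (u v : X) : 'D_u (lag p) v = 2 * lag_metric p v u.
Proof.
apply: derive_val; apply: is_derive_eq.
  rewrite /lag; isd_lag.
rewrite /lag_metric /=; ring.
Qed.

Lemma prolong1_lag (Y : J -> J) (v : X) :
  let z nu := 'D_d_s (eta Y nu) p
       + \sum_(mu < 5) 'D_(d_x mu) (eta Y nu) p * v 0 mu
       - 'D_d_s (xi Y) p * v 0 nu
       - \sum_(mu < 5) 'D_(d_x mu) (xi Y) p * v 0 mu * v 0 nu in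
  prolong1 Y lag p v =
    eta Y 1 p * lag_r v + eta Y 2 p * lag_th p v
    + 2 * lag_metric p v (\row_nu z nu).
Proof.
move=> z; rewrite /prolong1.
have -> : 'D_d_s (fun q => lag q v) p = 0.
  by rewrite derive_lag_pos /= !mxE !mulr0 addr0.
have -> : \sum_(nu < 5) eta Y nu p * 'D_(d_x nu) (fun q => lag q v) p
    = eta Y 1 p * lag_r v + eta Y 2 p * lag_th p v.
  by rewrite sum5 !derive_lag_pos !d_x_entry /=; ring.
rewrite mulr0 add0r; congr (_ + _).
rewrite (eq_bigr (fun nu => z nu * (2 * lag_metric p v (delta_mx 0 nu)))); last first.
  by move=> nu _; rewrite derive_lag_vel.
rewrite sum5 /lag_metric !mxE /=; ring.
Qed.

(** The fifteen components of L_eta g = lam g, where rho and Th are the r and th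
    components of eta, N nu mu stands for d eta^nu / dx^mu, and Z mu is the fibre
    component of d eta / dx^mu. *)
Definition killing_system (lam rho Th : R) (N : 'I_5 -> 'I_5 -> R) : Prop :=
  let r := p.2 0 1 in let th := p.2 0 2 in
  let s := sin th in let c := cos th in
  let Z mu := N 4 mu + c * N 3 mu in
  [/\ [/\ a' * rho + 2 * a r * N 0 0 = lam * a r,
          b' * rho + 2 * b r * N 1 1 = lam * b r,
          h' * rho + 2 * h r * N 2 2 = lam * h r,
          (h' * s ^+ 2 + w' * c ^+ 2) * rho + 2 * (h r - w r) * s * c * Th
            + 2 * h r * s ^+ 2 * N 3 3 + 2 * w r * c * Z 3
            = lam * (h r * s ^+ 2 + w r * c ^+ 2) &
          w' * rho + 2 * w r * Z 4 = lam * w r],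
      [/\ b r * N 1 0 = a r * N 0 1,
          h r * N 2 0 = a r * N 0 2,
          h r * s ^+ 2 * N 3 0 + w r * c * Z 0 = a r * N 0 3 &
          w r * Z 0 = a r * N 0 4],
      [/\ b r * N 1 2 + h r * N 2 1 = 0,
          b r * N 1 3 + h r * s ^+ 2 * N 3 1 + w r * c * Z 1 = 0 &
          b r * N 1 4 + w r * Z 1 = 0] &
      [/\ h r * (N 2 3 + s ^+ 2 * N 3 2) + w r * c * Z 2 = 0,
          h r * N 2 4 + w r * Z 2 = 0 &
          w' * c * rho - w r * s * Th + h r * s ^+ 2 * N 3 4
            + w r * c * Z 4 + w r * Z 3 = lam * w r * c]].

(** The components of 2 g(S, .) = B, where S stands for d eta/ds and B for the
    gradient of the gauge function. *)
Definition gauge_system (S B : 'I_5 -> R) : Prop :=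
  let r := p.2 0 1 in let th := p.2 0 2 in
  let s := sin th in let c := cos th in
  [/\ B 0 = - 2 * a r * S 0, B 1 = 2 * b r * S 1, B 2 = 2 * h r * S 2,
      B 3 = 2 * h r * s ^+ 2 * S 3 + 2 * w r * c * (S 4 + c * S 3) &
      B 4 = 2 * w r * (S 4 + c * S 3)].

(** The condition is cub + quad + lin + cst = 0 with each part homogeneous in
    the velocity. Evaluation at v, - v and 2 v separates the four parts, and
    evaluation at basis vectors and at sums of two of them gives the
    coefficients. *)
Lemma coefficient_equations (lam rho Th cst : R) (Xi S B : 'I_5 -> R)
    (N : 'I_5 -> 'I_5 -> R) :
  a (p.2 0 1) != 0 -> b (p.2 0 1) != 0 -> h (p.2 0 1) != 0 -> w (p.2 0 1) != 0 ->
  (forall v : X, rho * lag_r v + Th * lag_th p v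
    + 2 * lag_metric p v (\row_nu (S nu + \sum_(mu < 5) N nu mu * v 0 mu
        - lam * v 0 nu - \sum_(mu < 5) Xi mu * v 0 mu * v 0 nu))
    + (lam + \sum_(mu < 5) v 0 mu * Xi mu) * lag p v
    = cst + \sum_(mu < 5) v 0 mu * B mu) ->
  [/\ forall mu, Xi mu = 0, killing_system lam rho Th N & gauge_system S B].
Proof.
move=> a0 b0 h0 w0 E.
pose vec (v0 v1 v2 v3 v4 : R) : X := \row_(i < 5) [:: v0; v1; v2; v3; v4]`_i.
have {}E v0 v1 v2 v3 v4 := E (vec v0 v1 v2 v3 v4).
move: E a0 b0 h0 w0; rewrite /killing_system /gauge_system /lag_metric /lag_r /lag_th /lag.
move: (p.2 0 1) (p.2 0 2) => r th.
move: (a r) (b r) (h r) (w r) (sin th) (cos th) => ar br hr wr s c E a0 b0 h0 w0.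
pose L (v0 v1 v2 v3 v4 : R) := - ar * v0 ^+ 2 + br * v1 ^+ 2
  + hr * (v2 ^+ 2 + s ^+ 2 * v3 ^+ 2) + wr * (v4 + c * v3) ^+ 2.
pose cub v0 v1 v2 v3 v4 :=
  (Xi 0 * v0 + Xi 1 * v1 + Xi 2 * v2 + Xi 3 * v3 + Xi 4 * v4) * L v0 v1 v2 v3 v4.
pose Nv v0 v1 v2 v3 v4 nu :=
  N nu 0 * v0 + N nu 1 * v1 + N nu 2 * v2 + N nu 3 * v3 + N nu 4 * v4.
pose G (v0 v1 v2 v3 v4 : R) (u : 'I_5 -> R) :=
  - ar * v0 * u 0 + br * v1 * u 1
  + hr * (v2 * u 2 + s ^+ 2 * v3 * u 3) + wr * (v4 + c * v3) * (u 4 + c * u 3).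
pose quad v0 v1 v2 v3 v4 :=
  rho * (- a' * v0 ^+ 2 + b' * v1 ^+ 2 + h' * (v2 ^+ 2 + s ^+ 2 * v3 ^+ 2)
         + w' * (v4 + c * v3) ^+ 2)
  + Th * (2 * hr * s * c * v3 ^+ 2 - 2 * wr * s * (v4 + c * v3) * v3)
  + 2 * G v0 v1 v2 v3 v4 (Nv v0 v1 v2 v3 v4) - lam * L v0 v1 v2 v3 v4.
pose lin v0 v1 v2 v3 v4 := 2 * G v0 v1 v2 v3 v4 S
  - (B 0 * v0 + B 1 * v1 + B 2 * v2 + B 3 * v3 + B 4 * v4).
have {}E v0 v1 v2 v3 v4 : - cub v0 v1 v2 v3 v4 + quad v0 v1 v2 v3 v4
    + lin v0 v1 v2 v3 v4 - cst = 0.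
  move: (E v0 v1 v2 v3 v4); rewrite !sum5 !mxE /= !sum5 !mxE /=.
  move=> /eqP; rewrite -subr_eq0 => /eqP <-.
  rewrite /cub /quad /lin /G /L /Nv; ring.
have cancel (n : nat) (x : R) : n.+1%:R * x = 0 -> x = 0.
  by move/eqP; rewrite (mulf_eq0 (n.+1%:R : R)) pnatr_eq0/= => /eqP.
have c0 : cst = 0.
  have := E 0 0 0 0 0; rewrite /cub /quad /lin /G /L /Nv => H.
  rewrite -[LHS]opprK -[RHS]oppr0; congr (- _); rewrite -[RHS]H; ring.
have Q v0 v1 v2 v3 v4 : quad v0 v1 v2 v3 v4 = 0.
  have H : (- cub v0 v1 v2 v3 v4 + quad v0 v1 v2 v3 v4 + lin v0 v1 v2 v3 v4 - cst)
    + (- cub (- v0) (- v1) (- v2) (- v3) (- v4) + quad (- v0) (- v1) (- v2) (- v3) (- v4)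
      + lin (- v0) (- v1) (- v2) (- v3) (- v4) - cst)
    = 2 * (quad v0 v1 v2 v3 v4 - cst).
    rewrite /cub /quad /lin /G /L /Nv; ring.
  by move: H; rewrite !E c0 addr0 subr0 => /esym/cancel.
have C v0 v1 v2 v3 v4 : cub v0 v1 v2 v3 v4 = lin v0 v1 v2 v3 v4.
  have := E v0 v1 v2 v3 v4; rewrite Q c0 addr0 subr0 addrC => /eqP.
  by rewrite subr_eq0 => /eqP.
have C0 v0 v1 v2 v3 v4 : cub v0 v1 v2 v3 v4 = 0.
  have H : cub (2 * v0) (2 * v1) (2 * v2) (2 * v3) (2 * v4)
    - lin (2 * v0) (2 * v1) (2 * v2) (2 * v3) (2 * v4)
    - 2 * (cub v0 v1 v2 v3 v4 - lin v0 v1 v2 v3 v4) = 6 * cub v0 v1 v2 v3 v4.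
    rewrite /cub /lin /G /L; ring.
  by move: H; rewrite !C !subrr mulr0 subr0 -C => /esym/cancel.
have {}C v0 v1 v2 v3 v4 : lin v0 v1 v2 v3 v4 = 0 by rewrite -C C0.
split.
- have X0 : Xi 0 = 0.
    apply: (mulIf a0); rewrite mul0r -[RHS]oppr0 -(C0 1 0 0 0 0) /cub /L; ring.
  have X1 : Xi 1 = 0.
    apply: (mulIf b0); rewrite mul0r -[RHS](C0 0 1 0 0 0) /cub /L; ring.
  have X2 : Xi 2 = 0.
    apply: (mulIf h0); rewrite mul0r -[RHS](C0 0 0 1 0 0) /cub /L; ring.
  have X4 : Xi 4 = 0.
    apply: (mulIf w0); rewrite mul0r -[RHS](C0 0 0 0 0 1) /cub /L; ring.
  (* d/dphi may be null when k is negative; adding d/dr changes the Lagrangian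
     by b, which is not zero. *)
  have X3 : Xi 3 = 0.
    apply: (mulIf b0); rewrite mul0r.
    have e : Xi 3 * br = cub 0 1 0 1 0 - cub 0 0 0 1 0.
      rewrite /cub /L X1; ring.
    by rewrite e !C0 subrr.
  by elim/ord5_ind.
- have diag x y v0 v1 v2 v3 v4 : quad v0 v1 v2 v3 v4 = x - y -> x = y.
    by rewrite Q => /esym/eqP; rewrite subr_eq0 => /eqP.
  have pol x v0 v1 v2 v3 v4 u0 u1 u2 u3 u4 :
      quad (v0 + u0) (v1 + u1) (v2 + u2) (v3 + u3) (v4 + u4)
      - quad v0 v1 v2 v3 v4 - quad u0 u1 u2 u3 u4 = 2 * x -> x = 0.
    by rewrite !Q !subr0 => /esym/cancel.
  split; split.
  + apply/esym/(diag _ _ 1 0 0 0 0); rewrite /quad /G /L /Nv; ring.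
  + apply: (diag _ _ 0 1 0 0 0); rewrite /quad /G /L /Nv; ring.
  + apply: (diag _ _ 0 0 1 0 0); rewrite /quad /G /L /Nv; ring.
  + apply: (diag _ _ 0 0 0 1 0); rewrite /quad /G /L /Nv; ring.
  + apply: (diag _ _ 0 0 0 0 1); rewrite /quad /G /L /Nv; ring.
  + apply/subr0_eq/(pol _ 1 0 0 0 0 0 1 0 0 0); rewrite /quad /G /L /Nv; ring.
  + apply/subr0_eq/(pol _ 1 0 0 0 0 0 0 1 0 0); rewrite /quad /G /L /Nv; ring.
  + apply/subr0_eq/(pol _ 1 0 0 0 0 0 0 0 1 0); rewrite /quad /G /L /Nv; ring.
  + apply/subr0_eq/(pol _ 1 0 0 0 0 0 0 0 0 1); rewrite /quad /G /L /Nv; ring.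
  + apply: (pol _ 0 1 0 0 0 0 0 1 0 0); rewrite /quad /G /L /Nv; ring.
  + apply: (pol _ 0 1 0 0 0 0 0 0 1 0); rewrite /quad /G /L /Nv; ring.
  + apply: (pol _ 0 1 0 0 0 0 0 0 0 1); rewrite /quad /G /L /Nv; ring.
  + apply: (pol _ 0 0 1 0 0 0 0 0 1 0); rewrite /quad /G /L /Nv; ring.
  + apply: (pol _ 0 0 1 0 0 0 0 0 0 1); rewrite /quad /G /L /Nv; ring.
  + apply/subr0_eq/(pol _ 0 0 0 1 0 0 0 0 0 1); rewrite /quad /G /L /Nv; ring.
- have l v0 v1 v2 v3 v4 x y : lin v0 v1 v2 v3 v4 = y - x -> x = y.
    by rewrite C => /esym/eqP; rewrite subr_eq0 => /eqP.
  split.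
  + apply: (l 1 0 0 0 0); rewrite /lin /G; ring.
  + apply: (l 0 1 0 0 0); rewrite /lin /G; ring.
  + apply: (l 0 0 1 0 0); rewrite /lin /G; ring.
  + apply: (l 0 0 0 1 0); rewrite /lin /G; ring.
  + apply: (l 0 0 0 0 1); rewrite /lin /G; ring.
Qed.

Lemma noether_equations (Y : J -> J) (A : J -> R) :
  a (p.2 0 1) != 0 -> b (p.2 0 1) != 0 -> h (p.2 0 1) != 0 -> w (p.2 0 1) != 0 ->
  (forall v, prolong1 Y lag p v + total_s (xi Y) p v * lag p v = total_s A p v) ->
  [/\ forall mu, 'D_(d_x mu) (xi Y) p = 0,
      killing_system ('D_d_s (xi Y) p) (eta Y 1 p) (eta Y 2 p)
        (fun nu mu => 'D_(d_x mu) (eta Y nu) p) &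
      gauge_system (fun nu => 'D_d_s (eta Y nu) p) (fun mu => 'D_(d_x mu) A p)].
Proof.
move=> a0 b0 h0 w0 E.
apply: (@coefficient_equations _ _ _ ('D_d_s A p)
  (fun mu => 'D_(d_x mu) (xi Y) p)) => // v.
by rewrite -[RHS]E prolong1_lag.
Qed.

End Lagrangian.

(** * Partial derivatives on the strip, and the radial component *)

Section Partials.
Context {R : realType}.
Local Notation X := 'rV[R]_5.
Local Notation J := (R * 'rV[R]_5)%type.
Variables (D : set J) (oD : open D).

(** Naming the derivative by a variable F' keeps terms of the form 'D_v F out of
    the computations below. *)
Definition partial (v : J) (F F' : J -> R) : Prop :=
  forall p, D p -> is_derive p v F (F' p).

Lemma partial_self v (F : J -> R) : smooth_on D F ->
  partial v F (fun q => 'D_v F q).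
Proof.
by move=> sF p Dp; apply/derivableP/diff_derivable; exact: (smooth_on_differentiable sF).
Qed.

Lemma smooth_partial (v : J) (F : J -> R) : smooth_on D F ->
  exists2 F', smooth_on D F' & partial v F F'.
Proof.
move=> sF; exists (fun q => 'D_v F q); first exact: smooth_on_derive.
exact: partial_self.
Qed.

Lemma partialE v F F' p : partial v F F' -> D p -> 'D_v F p = F' p.
Proof. by move=> dF Dp; have df := dF p Dp; exact: derive_val. Qed.

Lemma partial_unique v F F' F'' p : partial v F F' -> partial v F F'' -> D p ->
  F' p = F'' p.
Proof. by move=> d1 d2 Dp; rewrite -(partialE d1 Dp) (partialE d2 Dp). Qed.

Lemma partial_eq v F G F' G' : (forall p, D p -> F p = G p) ->
  (forall p, D p -> F' p = G' p) -> partial v F F' -> partial v G G'.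
Proof.
move=> FG FG' dF p Dp; rewrite -FG'//.
exact: near_eq_is_derive (near_eq_on oD Dp FG) (dF p Dp).
Qed.

Lemma partial_ext v F F' F'' : partial v F F' ->
  (forall p, D p -> F' p = F'' p) -> partial v F F''.
Proof. by move=> dF e p Dp; rewrite -e//; exact: dF. Qed.

(** This is how an identity that holds throughout D is differentiated. *)
Lemma derive_zero (E : J -> R) v p e : (forall q, D q -> E q = 0) -> D p ->
  is_derive p v E e -> e = 0.
Proof.
move=> E0 Dp [_ <-]; rewrite (derive_eq_on (G := cst 0) v oD Dp E0).
by rewrite derive_cst.
Qed.

(** Symmetry of second derivatives: a derivative of Fv in the direction w is a
    derivative of Fw in the direction v. *)
Lemma partial_swap v w F Fv Fw Fvw : smooth_on D F ->
  partial v F Fv -> partial w F Fw -> smooth_on D Fw ->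
  partial w Fv Fvw -> partial v Fw Fvw.
Proof.
move=> sF dv dw sFw dvw p Dp.
rewrite -(partialE dvw Dp).
have <- : 'D_w (fun q => 'D_v F q) p = 'D_w Fv p.
  by apply: (derive_eq_on _ oD Dp) => q Dq; exact: partialE.
rewrite (schwarz v w oD sF Dp).
have -> : 'D_v (fun q => 'D_w F q) p = 'D_v Fw p.
  by apply: (derive_eq_on _ oD Dp) => q Dq; exact: partialE.
by apply/derivableP/diff_derivable; exact: (smooth_on_differentiable sFw).
Qed.

Lemma is_derive_horner_entry (P : {poly R}) (i : 'I_5) (p v : J) :
  is_derive p v (fun q : J => P.[q.2 0 i]) (P^`().[p.2 0 i] * v.2 0 i).
Proof. exact: is_derive_entry_comp. Qed.

Lemma smooth_entry (i : 'I_5) : smooth_on D (fun q : J => q.2 0 i).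
Proof.
apply: (@smooth_on_linear _ _ _ oD _ _ (entry i \o snd) id); last exact: smooth_on_id.
by move=> q; apply: continuous_comp; [exact: snd_continuous|exact: entry_continuous].
Qed.

End Partials.

(* The same for functions on the strip D; the derivatives of unknown functions
   are read off the [partial] hypotheses in the context. *)
Ltac isd Dp := repeat first
  [ eapply is_derive_const
  | match goal with H : partial _ ?v ?F _ |- is_derive _ ?v ?F _ => exact (H _ Dp) end
  | match goal with |- is_derive _ _ (fun q => ?P.[_]) _ => eapply is_derive_horner_entry end
  | eapply is_derive_entry
  | match goal with |- is_derive _ _ (fun q => sin _) _ =>
      eapply is_derive_entry_comp; eapply is_derive_sin end
  | match goal with |- is_derive _ _ (fun q => cos _) _ =>
      eapply is_derive_entry_comp; eapply is_derive_cos end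
  | match goal with |- is_derive _ _ (fun q => _ + _) _ => eapply is_derive_add end
  | match goal with |- is_derive _ _ (fun q => _ * _) _ => eapply is_derive_mul end
  | match goal with |- is_derive _ _ (fun q => - _) _ => eapply is_derive_opp end
  | match goal with |- is_derive _ _ (fun q => _ ^+ 2) _ => eapply is_derive_sqr end
  ].

(** The equations (rr), (ps ps), (r ps), (r th) and (th th), with denominators
    cleared. Here k stands for K^2, R0 for rinf, and Z for the component
    eta^ps + cos th eta^ph along the fibre. *)
Section RadialComponent.
Context {R : realType}.
Local Notation X := 'rV[R]_5.
Local Notation J := (R * 'rV[R]_5)%type.
Variables (U : set X) (oU : open U) (n : {poly R}) (k R0 : R).
Local Notation D := (setT `*` U : set J).
Local Notation r p := (p.2 0 1).
Hypotheses (n0 : n.[0] != 0) (R0_neq0 : R0 != 0).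
Hypotheses (r_neq0 : forall p, D p -> r p != 0)
           (n_neq0 : forall p, D p -> n.[r p] != 0).
Variables lam rho Th Z : J -> R.
Hypotheses (sl : smooth_on D lam) (srho : smooth_on D rho)
  (sT : smooth_on D Th) (sZ : smooth_on D Z).
Hypothesis dlam : forall i : 'I_5, partial D (d_x i) lam (fun=> 0).
Hypothesis rr : forall p, D p ->
  (4 * n.[r p] - r p * n^`().[r p]) * rho p + 2 * r p * n.[r p] * 'D_(d_x 1) rho p
  = lam p * r p * n.[r p].
Hypothesis psps : forall p, D p -> rho p = r p * (lam p / 2 - 'D_(d_x 4) Z p).
Hypothesis rps : forall p, D p ->
  4 * k * r p ^+ 2 * 'D_(d_x 4) rho p + n.[r p] * 'D_(d_x 1) Z p = 0.
Hypothesis rth : forall p, D p -> 'D_(d_x 2) rho p = 0 -> 'D_(d_x 1) Th p = 0.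
Hypothesis thth : forall p, D p ->
  2 * (r p ^+ 2 + R0 ^+ 2) * rho p
  + r p * (r p ^+ 2 - R0 ^+ 2) * (lam p - 2 * 'D_(d_x 2) Th p) = 0.

(** The function W below is rho / r, written as lam / 2 - Z_ps so that it is
    visibly smooth. The equations e1 and e4 are the two second order equations
    for W displayed at the top, and e8 is what cross-differentiation leaves. *)
Lemma radial_component_eq0 p : D p -> rho p = 0 /\ lam p = 0.
Proof.
have oD := open_strip oU.
have [Z4 sZ4 dZ4] := smooth_partial (d_x 4) sZ.
have [Z1 sZ1 dZ1] := smooth_partial (d_x 1) sZ.
pose W q := lam q * 2^-1 + (-1) * Z4 q.
have sW : smooth_on D W.
  by apply: smooth_onD => //; apply: smooth_onM => //; exact: smooth_on_cst.
have rhoW q : D q -> rho q = r q * W q.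
  by move=> Dq; rewrite psps// (partialE dZ4)// /W mulN1r.
have [Z14 sZ14 dZ14] := smooth_partial (d_x 4) sZ1.
have dZ41 : partial D (d_x 1) Z4 Z14 := partial_swap oD sZ dZ1 dZ4 sZ4 dZ14.
have dWZ : partial D (d_x 1) W (fun q => - Z14 q).
  move=> q Dq; apply: is_derive_eq; first by (rewrite /W; isd Dq; exact: dlam).
  rewrite mul0r mulr0 mul0r add0r add0r; ring.
clearbody W.
have [W1 sW1 dW1] := smooth_partial (d_x 1) sW.
have [W2 sW2 dW2] := smooth_partial (d_x 2) sW.
have [W4 sW4 dW4] := smooth_partial (d_x 4) sW.
have [W44 sW44 dW44] := smooth_partial (d_x 4) sW4.
have [W14 sW14 dW14] := smooth_partial (d_x 4) sW1.
have [W144 sW144 dW144] := smooth_partial (d_x 4) sW14.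
have dW41 : partial D (d_x 1) W4 W14 := partial_swap oD sW dW1 dW4 sW4 dW14.
have dW441 : partial D (d_x 1) W44 W144 := partial_swap oD sW4 dW41 dW44 sW44 dW144.
have drho i Wi q : partial D (d_x i) W Wi -> D q ->
    'D_(d_x i) rho q = (i == 1)%:R * W q + r q * Wi q.
  move=> dWi Dq; rewrite (derive_eq_on (G := fun q : J => r q * W q) _ oD Dq rhoW).
  apply: derive_val; apply: is_derive_eq; first isd Dq.
  by rewrite d_x_entry eq_sym.
have Z14E q : D q -> Z14 q = - W1 q.
  by move=> Dq; rewrite (partial_unique dW1 dWZ Dq) opprK.
have e1 q : D q -> 2 * r q * n.[r q] * W1 q
    + (6 * n.[r q] - r q * n^`().[r q]) * W q - lam q * n.[r q] = 0.
  move=> Dq; apply: (mulfI (r_neq0 Dq)); rewrite mulr0.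
  have := rr Dq; rewrite (drho _ _ _ dW1 Dq) rhoW// => /eqP.
  rewrite -subr_eq0 => /eqP <-; rewrite /=; ring.
have e2 q : D q -> 4 * k * r q ^+ 2 * r q * W4 q + n.[r q] * Z1 q = 0.
  by move=> Dq; have := rps Dq; rewrite (drho _ _ _ dW4 Dq) (partialE dZ1 Dq)
     /= mul0r add0r !mulrA.
have e3 q : D q -> 4 * k * r q ^+ 2 * r q * W44 q - n.[r q] * W1 q = 0.
  move=> Dq; have d : is_derive q (d_x 4) (fun q : J => 4 * k * r q ^+ 2 * r q * W4 q
      + n.[r q] * Z1 q) (4 * k * r q ^+ 2 * r q * W44 q + n.[r q] * Z14 q).
    apply: is_derive_eq; first isd Dq.
    rewrite !d_x_entry /=; ring.
  by have := derive_zero oD e2 Dq d; rewrite Z14E// mulrN.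
have e4 q : D q -> 8 * k * r q ^+ 2 * r q ^+ 2 * W44 q
    + (6 * n.[r q] - r q * n^`().[r q]) * W q - lam q * n.[r q] = 0.
  move=> Dq; have <- : 2 * r q * n.[r q] * W1 q
      + (6 * n.[r q] - r q * n^`().[r q]) * W q - lam q * n.[r q]
      + 2 * r q * (4 * k * r q ^+ 2 * r q * W44 q - n.[r q] * W1 q)
    = 8 * k * r q ^+ 2 * r q ^+ 2 * W44 q
      + (6 * n.[r q] - r q * n^`().[r q]) * W q - lam q * n.[r q] by ring.
  by rewrite e1// e3// mulr0 addr0.
have e5 q : D q -> 32 * k * r q ^+ 3 * W44 q + 8 * k * r q ^+ 4 * W144 q
    + (5 * n^`().[r q] - r q * n^`()^`().[r q]) * W q
    + (6 * n.[r q] - r q * n^`().[r q]) * W1 q - lam q * n^`().[r q] = 0.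
  move=> Dq; apply: (derive_zero (v := d_x 1) oD e4 Dq).
  apply: is_derive_eq; first by isd Dq; exact: dlam.
  rewrite !d_x_entry /=; ring.
have e6 q : D q -> 2 * r q * n.[r q] * W14 q
    + (6 * n.[r q] - r q * n^`().[r q]) * W4 q = 0.
  move=> Dq; apply: (derive_zero (v := d_x 4) oD e1 Dq).
  apply: is_derive_eq; first by isd Dq; exact: dlam.
  rewrite !d_x_entry /=; ring.
have e7 q : D q -> 2 * r q * n.[r q] * W144 q
    + (6 * n.[r q] - r q * n^`().[r q]) * W44 q = 0.
  move=> Dq; apply: (derive_zero (v := d_x 4) oD e6 Dq).
  apply: is_derive_eq; first by isd Dq.
  rewrite !d_x_entry /=; ring.
pose g := 'X ^+ 2 * n^`()^`() - 9%:P * 'X * n^`() + 24%:P * n.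
have gE x : g.[x] = x ^+ 2 * n^`()^`().[x] - 9 * x * n^`().[x] + 24 * n.[x].
  by rewrite /g !hornerE.
have g_neq0 : g != 0.
  apply: contraNneq n0 => g0; have := gE 0.
  rewrite g0 horner0 expr2 !mul0r mulr0 mul0r subrr add0r => /esym/eqP.
  by rewrite mulf_eq0 (pnatr_eq0 R 24).
(* n times e8 is a combination of e4, its r-derivative e5, the second
   ps-derivative e7 of e1, and e1: W_psps and its r-derivative cancel. *)
have e8 q : D q -> g.[r q] * W q - lam q * (4 * n.[r q] - r q * n^`().[r q]) = 0.
  move=> Dq; have nn : - (2 * n.[r q]) != 0 by rewrite oppr_eq0 mulf_neq0// n_neq0.
  apply: (mulfI nn); rewrite mulr0 gE.
  set m := 6 * n.[r q] - r q * n^`().[r q].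
  have <- : 2 * n.[r q] * (r q * (32 * k * r q ^+ 3 * W44 q + 8 * k * r q ^+ 4 * W144 q
      + (5 * n^`().[r q] - r q * n^`()^`().[r q]) * W q
      + m * W1 q - lam q * n^`().[r q])
     - 4 * (8 * k * r q ^+ 2 * r q ^+ 2 * W44 q + m * W q - lam q * n.[r q]))
    - 8 * k * r q ^+ 4 * (2 * r q * n.[r q] * W144 q + m * W44 q)
    + m * (8 * k * r q ^+ 2 * r q ^+ 2 * W44 q + m * W q - lam q * n.[r q])
    - m * (2 * r q * n.[r q] * W1 q + m * W q - lam q * n.[r q])
    = - (2 * n.[r q]) * ((r q ^+ 2 * n^`()^`().[r q] - 9 * r q * n^`().[r q]
        + 24 * n.[r q]) * W q - lam q * (4 * n.[r q] - r q * n^`().[r q])).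
    rewrite /m; ring.
  by rewrite e1// e4// e5// e7// !mulr0 !subrr !mulr0 !subr0 add0r.
have rE (q : J) t : r (q + t *: d_x 1) = r q + t.
  by rewrite /= !mxE eqxx mulr1.
(* e8 is differentiated in an angle; lam and all coefficients are constant
   in that direction. *)
have W_angular i Wi : smooth_on D Wi -> partial D (d_x i) W Wi -> i != 1 ->
    forall q, D q -> Wi q = 0.
  move=> sWi dWi i1; apply: (poly_mul_eq0 oD rE g_neq0) => q Dq.
    exact: differentiable_continuous (smooth_on_differentiable sWi Dq).
  apply: (derive_zero (v := d_x i) oD e8 Dq).
  apply: is_derive_eq; first by isd Dq; exact: dlam.
  rewrite !d_x_entry eq_sym (negbTE i1) /=; ring.
have W4_0 := W_angular 4 W4 sW4 dW4 isT.
have W2_0 := W_angular 2 W2 sW2 dW2 isT.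
have W1_0 q : D q -> W1 q = 0.
  move=> Dq; apply: (mulfI (n_neq0 Dq)); rewrite mulr0.
  have := e3 q Dq; have -> : W44 q = 0 := derive_zero oD W4_0 Dq (dW44 q Dq).
  by rewrite mulr0 sub0r => /eqP; rewrite oppr_eq0 => /eqP.
have [T1 sT1 dT1] := smooth_partial (d_x 1) sT.
have [T2 sT2 dT2] := smooth_partial (d_x 2) sT.
have [T12 sT12 dT12] := smooth_partial (d_x 2) sT1.
have dT21 : partial D (d_x 1) T2 T12 := partial_swap oD sT dT1 dT2 sT2 dT12.
have T1_0 q : D q -> T1 q = 0.
  move=> Dq; rewrite -(partialE dT1 Dq); apply: rth => //.
  by rewrite (drho _ _ _ dW2 Dq) W2_0// mulr0 mul0r addr0.
have T12_0 q (Dq : D q) : T12 q = 0 := derive_zero oD T1_0 Dq (dT12 q Dq).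
(* (th th) is linear in W and lam - 2 Th_th, both independent of r; at
   r = rinf only the first term survives. *)
have W_0 q : D q -> W q = 0.
  move=> Dq; pose a := 2%:P * ('X ^+ 2 + (R0 ^+ 2)%:P); pose b := 'X ^+ 2 - (R0 ^+ 2)%:P.
  have aE x : a.[x] = 2 * (x ^+ 2 + R0 ^+ 2) by rewrite /a !hornerE.
  have bE x : b.[x] = x ^+ 2 - R0 ^+ 2 by rewrite /b !hornerE.
  have dV : partial D (d_x 1) (fun x => lam x + (- 2) * T2 x) (fun=> 0).
    move=> x Dx; apply: is_derive_eq; first by isd Dx; exact: dlam.
    by rewrite T12_0// mul0r mulr0 !addr0.
  have sV : smooth_on D (fun x => lam x + (- 2) * T2 x).
    by apply: smooth_onD => //; apply: smooth_onM => //; exact: smooth_on_cst.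
  have := @radial_extension _ _ _ oD _ _ rE W (fun x => lam x + (- 2) * T2 x) a b
    (fun x => @smooth_on_differentiable _ _ _ _ W x sW)
    (fun x Dx => etrans (partialE dW1 Dx) (W1_0 x Dx))
    (fun x => @smooth_on_differentiable _ _ _ _ _ x sV)
    (fun x Dx => partialE dV Dx).
  move=> /(_ _ q R0); rewrite aE bE subrr mulr0 addr0 => ext.
  have /eqP : W q * (2 * (R0 ^+ 2 + R0 ^+ 2)) = 0.
    apply: ext => // x Dx; rewrite aE bE; apply: (mulfI (r_neq0 Dx)).
    have := thth Dx; rewrite rhoW// (partialE dT2 Dx) mulr0 => <-; ring.
  have -> : 2 * (R0 ^+ 2 + R0 ^+ 2) = 4 * R0 ^+ 2 by ring.
  by rewrite !mulf_eq0 (pnatr_eq0 R 4) (negbTE R0_neq0) !orbF => /eqP.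
move=> Dp; split; first by rewrite rhoW// W_0// mulr0.
have := rr Dp; rewrite (drho _ _ _ dW1 Dp) rhoW// W_0// W1_0// !(mulr0, addr0) => /esym/eqP.
by rewrite !mulf_eq0 (negbTE (r_neq0 Dp)) (negbTE (n_neq0 Dp)) !orbF => /eqP.
Qed.

End RadialComponent.

(** * The metric coefficients as rational functions of r *)

Section BlackHoleCoefficients.
Context {R : realType}.
Local Notation X := 'rV[R]_5.
Local Notation J := (R * 'rV[R]_5)%type.
Variables M q rinf : R.

Definition coef_r (r : R) : R := bh_k M q rinf r ^+ 2 / bh_f M q r.
Definition coef_base (r : R) : R := r ^+ 2 / 4 * bh_k M q rinf r.
Definition coef_fibre (r : R) : R := r ^+ 2 / 4.
Definition kconst : R := bh_f M q rinf * rinf ^+ 4.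
(** The numerators and denominators of f = fpol / r^4 and k = kconst / gpol, and
    npol = fpol gpol^2, for which the coefficient of dr^2 is
    kconst^2 r^4 / npol. *)
Definition fpol : {poly R} := 'X ^+ 4 - (2 * M)%:P * 'X ^+ 2 + (q ^+ 2)%:P.
Definition gpol : {poly R} := ('X ^+ 2 - (rinf ^+ 2)%:P) ^+ 2.

Lemma fpolE r : fpol.[r] = r ^+ 4 - 2 * M * r ^+ 2 + q ^+ 2.
Proof. by rewrite /fpol !hornerE. Qed.

Lemma gpolE r : gpol.[r] = (r ^+ 2 - rinf ^+ 2) ^+ 2.
Proof. by rewrite /gpol !hornerE. Qed.

Lemma gpol_deriv r : gpol^`().[r] = 4 * r * (r ^+ 2 - rinf ^+ 2).
Proof. rewrite /gpol expr2 !poly.derivE !(hornerE, hornerMn) /=; ring. Qed.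

Definition npol : {poly R} := fpol * gpol ^+ 2.

Lemma npolE r : npol.[r] = fpol.[r] * gpol.[r] ^+ 2.
Proof. by rewrite /npol hornerM horner_exp. Qed.

Lemma bh_kE r : bh_k M q rinf r = kconst / gpol.[r].
Proof. by rewrite gpolE. Qed.

Lemma bh_lagE : bh_lagrangian M q rinf
  = lag (bh_f M q) coef_r coef_base coef_fibre.
Proof.
apply/funext => -[s x]; apply/funext => v.
rewrite bh_lagrangianE /lag /coef_base /coef_fibre /coef_r /=.
by move: (_ / bh_f _ _ _) (sin _) (cos _) => z sn cs; field.
Qed.

Lemma bh_fE r : r != 0 -> bh_f M q r = fpol.[r] / r ^+ 4.
Proof. by move=> r0; rewrite fpolE /bh_f; field. Qed.

Lemma coef_rE r : r != 0 -> coef_r r = kconst ^+ 2 * r ^+ 4 / npol.[r].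
Proof.
move=> r0; rewrite /coef_r bh_fE// bh_kE npolE !invfM !invrK.
by move: _.[r]^-1 _.[r]^-1 => x y; ring.
Qed.

Lemma coef_baseE r : coef_base r = kconst / 4 * r ^+ 2 / gpol.[r].
Proof. rewrite /coef_base bh_kE; move: _^-1 => x; ring. Qed.

Lemma is_derive_sqrX (x : R) : is_derive x 1 (fun t : R => t ^+ 2) (2 * x).
Proof. by apply: is_derive_eq (is_derive_sqr (is_derive_id _ _)) _; rewrite mulr1. Qed.

Lemma is_derive_ratio (P Q : {poly R}) (x : R) : Q.[x] != 0 ->
  is_derive x 1 (fun t => P.[t] / Q.[t])
    ((P^`().[x] * Q.[x] - P.[x] * Q^`().[x]) / Q.[x] ^+ 2).
Proof.
move=> Q0; apply: is_derive_eq
  (is_derive_mul (is_derive_poly P x) (is_derive_inv Q0 (is_derive_poly Q x))) _.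
by field.
Qed.

Lemma near_neq0 (x : R) : x != 0 -> \forall t \near x, t != 0.
Proof.
move=> x0; apply/nbhs_normP; exists `|x| => /=; first by rewrite normr_gt0.
by move=> t /=; apply: contraTneq => ->; rewrite subr0 ltxx.
Qed.

(** Nondegeneracy of the metric enters only through kconst, which must not
    vanish. *)
Lemma bh_region_neq0 (x : X) : bh_region M q rinf x ->
  [/\ [/\ x 0 1 != 0, sin (x 0 2) != 0 & rinf != 0],
      kconst != 0, fpol.[x 0 1] != 0 & gpol.[x 0 1] != 0].
Proof.
move=> [/andP[r0 rR] /andP[th0 thpi] _ _ [f0 nd]].
have rn0 : x 0 1 != 0 by rewrite gt_eqF.
have R0 : 0 < rinf by exact: lt_trans rR.
split.
- by split=> //; rewrite gt_eqF// sin_gt0_pi// thpi th0.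
- (* if f(rinf) = 0 then k = 0 and d/dr is in the kernel of the metric *)
  apply/eqP => K0; have k0 : bh_k M q rinf (x 0 1) = 0 by rewrite bh_kE K0 mul0r.
  have /matrixP/(_ 0 1) : (delta_mx 0 1 : X) = 0.
    apply: nd => w; rewrite /bh_metric /sigma3 k0 !mxE /= expr2 !mul0r.
    by rewrite !(mulr0, mul0r, addr0).
  by rewrite !mxE /= => /eqP; rewrite oner_eq0.
- by move: f0; rewrite bh_fE//; apply: contraNneq => ->; rewrite mul0r.
- rewrite gpolE expf_neq0// subr_eq0 lt_eqF//.
  by rewrite ltrXn2r// ltW.
Qed.

Lemma horner_monomial (c x : R) m : (c *: 'X ^+ m).[x] = c * x ^+ m.
Proof. by rewrite hornerZ horner_exp hornerX. Qed.

Lemma horner_monomial_deriv (c x : R) m :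
  (c *: 'X ^+ m)^`().[x] = c * m%:R * x ^+ m.-1.
Proof. by rewrite derivZ derivXn hornerZ hornerMn horner_exp hornerX -mulr_natl mulrA. Qed.

(** The last two equations are the logarithmic derivatives of b and h with
    denominators cleared, the form in which the radial argument uses them. *)
Lemma bh_coefficients_derive (r : R) : r != 0 -> fpol.[r] != 0 -> gpol.[r] != 0 ->
  exists a' b' h' : R,
  [/\ is_derive r 1 (bh_f M q) a', is_derive r 1 coef_r b',
      is_derive r 1 coef_base h', is_derive r 1 coef_fibre (r / 2) &
      r * npol.[r] * b' = (4 * npol.[r] - r * npol^`().[r]) * coef_r r
      /\ (r ^+ 2 - rinf ^+ 2) * r * h' = - 2 * (r ^+ 2 + rinf ^+ 2) * coef_base r].
Proof.
move=> r0 F0 G0.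
have n0 : npol.[r] != 0 by rewrite npolE mulf_neq0// expf_neq0.
have d4 : ('X ^+ 4 : {poly R}).[r] != 0 by rewrite !hornerE !mulf_neq0.
do 3 eexists; split.
- apply: near_eq_is_derive (is_derive_ratio fpol d4).
  by apply: filterS (near_neq0 r0) => t t0; rewrite bh_fE// horner_exp hornerX.
- apply: near_eq_is_derive (is_derive_ratio ((kconst ^+ 2) *: 'X ^+ 4) n0).
  apply: filterS (near_neq0 r0) => t t0.
  by rewrite coef_rE// horner_monomial.
- apply: near_eq_is_derive (is_derive_ratio ((kconst / 4) *: 'X ^+ 2) G0).
  by apply: filterS (near_neq0 r0) => t _; rewrite coef_baseE// horner_monomial.
- apply: is_derive_eq (is_derive_mul (is_derive_sqrX r) (is_derive_const 4^-1 r 1)) _.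
  by field.
- split.
    rewrite coef_rE// horner_monomial horner_monomial_deriv.
    move: npol.[r] npol^`().[r] n0 => n n' n0; by field.
  rewrite coef_baseE horner_monomial horner_monomial_deriv gpol_deriv gpolE.
  move: G0; rewrite gpolE sqrf_eq0 => G0; by field.
Qed.

End BlackHoleCoefficients.

(** * Separation of the remaining Killing equations *)

Lemma mulIf0 {R : fieldType} (c x : R) : c != 0 -> x * c = 0 -> x = 0.
Proof. by move=> c0 /eqP; rewrite mulf_eq0 (negbTE c0) orbF => /eqP. Qed.

(** Here y nu are the components of eta, N nu i and S nu their derivatives in
    x^i and in s, B i the derivatives of the gauge function, and lam is
    d xi/ds. *)
Section KillingFields.
Context {R : realType}.
Local Notation X := 'rV[R]_5.
Local Notation J := (R * 'rV[R]_5)%type.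
Variables (M q rinf : R) (U : set X).
Hypotheses (q_neq0 : q != 0) (oU : open U) (U_region : U `<=` bh_region M q rinf).
Local Notation D := (setT `*` U : set J).
Local Notation a := (bh_f M q).
Local Notation b := (coef_r M q rinf).
Local Notation h := (coef_base M q rinf).
Local Notation w := coef_fibre.
Local Notation K := (kconst M q rinf).
Local Notation F := (fpol M q).
Local Notation G := (gpol rinf).
Local Notation n := (npol M q rinf).
Local Notation r p := (p.2 0 1).
Local Notation th p := (p.2 0 2).

Variables (lam A : J -> R) (y S B : 'I_5 -> J -> R) (N : 'I_5 -> 'I_5 -> J -> R).
Hypotheses (slam : smooth_on D lam) (dlam : forall i : 'I_5, partial D (d_x i) lam (fun=> 0)).
Hypotheses (sA : smooth_on D A) (sB : forall i, smooth_on D (B i))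
  (dB : forall i, partial D (d_x i) A (B i)).
Hypotheses (sy : forall nu, smooth_on D (y nu))
  (sN : forall nu i, smooth_on D (N nu i))
  (dN : forall nu i, partial D (d_x i) (y nu) (N nu i))
  (sS : forall nu, smooth_on D (S nu)) (dS : forall nu, partial D d_s (y nu) (S nu)).
Hypothesis killing : forall p, D p -> forall a' b' h' w',
  is_derive (r p) 1 a a' -> is_derive (r p) 1 b b' ->
  is_derive (r p) 1 h h' -> is_derive (r p) 1 w w' ->
  killing_system a b h w p a' b' h' w' (lam p) (y 1 p) (y 2 p) (fun nu i => N nu i p).
Hypothesis gauge : forall p, D p ->
  gauge_system a b h w p (fun nu => S nu p) (fun i => B i p).

Let oD : open D := open_strip oU.

Let region p : D p -> [/\ [/\ r p != 0, sin (th p) != 0 & rinf != 0],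
      K != 0, F.[r p] != 0 & G.[r p] != 0].
Proof. by move=> [_ /= Up]; exact: bh_region_neq0 (U_region Up). Qed.

Let n_neq0 p : D p -> n.[r p] != 0.
Proof.
by move=> /region[_ _ F0 G0]; rewrite npolE mulf_neq0// expf_neq0.
Qed.

Let b_neq0 p : D p -> b (r p) != 0.
Proof.
move=> Dp; have [[r0 _ _] K0 _ _] := region Dp.
rewrite coef_rE//; apply: mulf_neq0; last by rewrite invr_neq0// n_neq0.
by rewrite mulf_neq0// expf_neq0.
Qed.

Let h_neq0 p : D p -> h (r p) != 0.
Proof.
move=> Dp; have [[r0 _ _] K0 _ G0] := region Dp.
rewrite coef_baseE; apply: mulf_neq0; last by rewrite invr_neq0.
by rewrite mulf_neq0 ?expf_neq0// mulf_neq0// invr_neq0// pnatr_eq0.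
Qed.

Let w_neq0 p : D p -> w (r p) != 0.
Proof.
move=> Dp; have [[r0 _ _] _ _ _] := region Dp.
by rewrite /coef_fibre mulf_neq0 ?expf_neq0// invr_neq0// pnatr_eq0.
Qed.

(** The equations of [killing_system] are brought to the cleared form that
    [radial_component_eq0] expects; n(0) = q^2 rinf^8 is where the charge is
    used. *)
Lemma radial_and_scaling_eq0 p : D p -> y 1 p = 0 /\ lam p = 0.
Proof.
move=> Dp; have [[_ _ R0] _ _ _] := region Dp.
pose Z p := y 4 p + cos (th p) * y 3 p.
have dZ i (i2 : i != 2) : partial D (d_x i) Z
    (fun x => N 4 i x + cos (th x) * N 3 i x).
  move=> x Dx; apply: is_derive_eq.
    apply: is_derive_add; first exact: (dN 4 i).
    apply: is_derive_mul; last exact: (dN 3 i).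
    by apply: is_derive_entry_comp; exact: is_derive_cos.
  by rewrite d_x_entry eq_sym (negbTE i2) mulr0 mul0r add0r.
have sZ : smooth_on D Z.
  apply: smooth_onD => //; apply: smooth_onM => //.
  by apply: elementary_smooth => //; apply: elem_cos; apply: elem_smooth; exact: smooth_entry.
have eqs x : D x -> exists a' b' h',
    [/\ r x * n.[r x] * b' = (4 * n.[r x] - r x * n^`().[r x]) * b (r x),
      (r x ^+ 2 - rinf ^+ 2) * r x * h' = - 2 * (r x ^+ 2 + rinf ^+ 2) * h (r x) &
      killing_system a b h w x a' b' h' (r x / 2) (lam x) (y 1 x) (y 2 x)
        (fun nu i => N nu i x)].
  move=> Dx; have [[r0 _ _] _ F0 G0] := region Dx.
  have [a' [b' [h' [da db dh dw [eb eh]]]]] := bh_coefficients_derive r0 F0 G0.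
  by exists a', b', h'; split=> //; exact: killing.
apply: (@radial_component_eq0 _ U oU n (K ^+ 2) rinf _ R0 _ n_neq0
  lam (y 1) (y 2) Z) => //.
- have -> : n.[0] = q ^+ 2 * rinf ^+ 8 by rewrite npolE fpolE gpolE; ring.
  by rewrite mulf_neq0 ?expf_neq0.
- by move=> x Dx; have [[]] := region Dx.
- move=> x Dx; rewrite (partialE (dN 1 1) Dx).
  have [a' [b' [h' [eb _ [[_ rr _ _ _] _ _ _]]]]] := eqs x Dx.
  apply: (mulfI (b_neq0 Dx)).
  have <- : r x * n.[r x] * (lam x * b (r x)) = b (r x) * (lam x * r x * n.[r x]) by ring.
  have -> : r x * n.[r x] * (lam x * b (r x)) =
      (r x * n.[r x] * b') * y 1 x + 2 * (r x * n.[r x]) * b (r x) * N 1 1 x.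
    rewrite -rr; ring.
  rewrite eb; ring.
- move=> x Dx; rewrite (partialE (dZ 4 isT) Dx).
  have [[r0 _ _] _ _ _] := region Dx.
  have [a' [b' [h' [_ _ [[_ _ _ _ pp] _ _ _]]]]] := eqs x Dx.
  apply: (mulfI r0).
  apply/eqP; rewrite -subr_eq0; apply/eqP; move: pp; rewrite /coef_fibre => /eqP.
  rewrite -subr_eq0 => /eqP e; rewrite -[RHS](mulr0 2) -e; by field.
- move=> x Dx; rewrite (partialE (dN 1 4) Dx) (partialE (dZ 1 isT) Dx).
  have [[r0 _ _] _ _ _] := region Dx.
  have [a' [b' [h' [_ _ [_ _ [_ _ rps] _]]]]] := eqs x Dx.
  have := n_neq0 Dx; move: rps; rewrite coef_rE// /coef_fibre; move: n.[_] => m rps m0.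
  have c0 : r x ^+ 2 / (4 * m) != 0.
    by rewrite mulf_neq0 ?expf_neq0 ?invr_neq0 ?mulf_neq0.
  apply: (mulfI c0); rewrite mulr0 -rps; by field.
- move=> x Dx; rewrite (partialE (dN 1 2) Dx) (partialE (dN 2 1) Dx) => e.
  have [a' [b' [h' [_ _ [_ _ [rth _ _] _]]]]] := eqs x Dx.
  by apply: (mulfI (h_neq0 Dx)); rewrite mulr0 -rth e mulr0 add0r.
- move=> x Dx; rewrite (partialE (dN 2 2) Dx).
  have [a' [b' [h' [_ eh [[_ _ tt _ _] _ _ _]]]]] := eqs x Dx.
  apply: (mulfI (h_neq0 Dx)); rewrite mulr0.
  have <- : - ((r x ^+ 2 - rinf ^+ 2) * r x * (h' * y 1 x + 2 * h (r x) * N 2 2 x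
     - lam x * h (r x))) = h (r x) * (2 * (r x ^+ 2 + rinf ^+ 2) * y 1 x
    + r x * (r x ^+ 2 - rinf ^+ 2) * (lam x - 2 * N 2 2 x)).
    transitivity (- ((r x ^+ 2 - rinf ^+ 2) * r x * h') * y 1 x
      + r x * (r x ^+ 2 - rinf ^+ 2) * h (r x) * (lam x - 2 * N 2 2 x)); first by ring.
    by rewrite eh; ring.
  by rewrite tt subrr mulr0 oppr0.
Qed.

Let rad0 p (Dp : D p) : y 1 p = 0 := (radial_and_scaling_eq0 Dp).1.
Let lam0 p (Dp : D p) : lam p = 0 := (radial_and_scaling_eq0 Dp).2.

Let N1_0 i p (Dp : D p) : N 1 i p = 0 := derive_zero oD (@rad0) Dp (@dN 1 i p Dp).
Let S1_0 p (Dp : D p) : S 1 p = 0 := derive_zero oD (@rad0) Dp (@dS 1 p Dp).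

(** The coefficients allowed in [radial_extension]. *)
Definition radially_constant (f : J -> R) : Prop :=
  smooth_on D f /\ partial D (d_x 1) f (fun=> 0).
Local Notation rc := radially_constant.

(** If f does not depend on r, neither do its derivatives in other
    directions. *)
Lemma rc_mixed v f g : smooth_on D f -> partial D (d_x 1) f (fun=> 0) ->
  smooth_on D g -> partial D v f g -> rc g.
Proof.
move=> sf df sg dg; split=> //.
apply: (partial_swap oD sf df dg sg) => p Dp; exact: is_derive_const.
Qed.

Lemma rc_add f g : rc f -> rc g -> rc (fun p => f p + g p).
Proof.
move=> [sf df] [sg dg]; split; first exact: smooth_onD.
by move=> p Dp; apply: is_derive_eq (is_derive_add (df p Dp) (dg p Dp)) _; rewrite addr0.
Qed.

Lemma rc_mul f g : rc f -> rc g -> rc (fun p => f p * g p).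
Proof.
move=> [sf df] [sg dg]; split; first exact: smooth_onM.
move=> p Dp; apply: is_derive_eq (is_derive_mul (df p Dp) (dg p Dp)) _.
by rewrite mul0r mulr0 addr0.
Qed.

Lemma rc_cst (c : R) : rc (fun=> c).
Proof. by split; [exact: smooth_on_cst|move=> p _; exact: is_derive_const]. Qed.

Lemma rc_sin : rc (fun p : J => sin (th p)).
Proof.
split.
  by apply: elementary_smooth => //; apply: elem_sin; apply: elem_smooth; exact: smooth_entry.
move=> p _; apply: is_derive_eq (is_derive_entry_comp _ (is_derive_sin _)) _.
by rewrite d_x_entry mulr0.
Qed.

Lemma rc_cos : rc (fun p : J => cos (th p)).
Proof.
split.
  by apply: elementary_smooth => //; apply: elem_cos; apply: elem_smooth; exact: smooth_entry.
move=> p _; apply: is_derive_eq (is_derive_entry_comp _ (is_derive_cos _)) _.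
by rewrite d_x_entry mulr0.
Qed.

(** [radial_extension] for the radial coordinate of the strip. *)
Lemma separate f g (P Q : {poly R}) : rc f -> rc g ->
  (forall p, D p -> f p * P.[r p] + g p * Q.[r p] = 0) ->
  forall p x, D p -> f p * P.[x] + g p * Q.[x] = 0.
Proof.
move=> [sf df] [sg dg]; apply: (@radial_extension _ _ _ oD (fun p : J => r p) (d_x 1)).
- by move=> p t; rewrite /= !mxE eqxx mulr1.
- by move=> p; exact: smooth_on_differentiable.
- by move=> p Dp; rewrite (partialE df).
- by move=> p; exact: smooth_on_differentiable.
- by move=> p Dp; rewrite (partialE dg).
Qed.

Let F_0 : F.[0] = q ^+ 2.
Proof. rewrite fpolE; ring. Qed.
Let G_rinf : G.[rinf] = 0.
Proof. rewrite gpolE; ring. Qed.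
Let G_0 : G.[0] = rinf ^+ 4.
Proof. rewrite gpolE; ring. Qed.

(** Cleared of denominators, the equation is K r^6 f = 4 fpol gpol g. At
    r = rinf the right side vanishes, and at r = 0 the left side does. *)
Lemma separate_base_time f g : rc f -> rc g ->
  (forall p, D p -> h (r p) * f p = a (r p) * g p) ->
  forall p, D p -> f p = 0 /\ g p = 0.
Proof.
move=> rf rg fg p Dp; have [[_ _ R0] K0 _ _] := region Dp.
have ext H x := @separate f g (K *: 'X ^+ 6) ((- 4) *: (F * G)) rf rg H p x Dp.
have {}ext x : f p * (K * x ^+ 6) + g p * (- 4 * (F.[x] * G.[x])) = 0.
  move: (ext^~ x); rewrite horner_monomial hornerZ (hornerM F G); apply => u Du.
  have [[r0 _ _] _ _ G0] := region Du; have := fg u Du.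
  rewrite coef_baseE bh_fE// horner_monomial hornerZ (hornerM F G).
  move: F.[_] G.[_] G0 => Fu Gu Gu0 e.
  have -> : f u * (K * r u ^+ 6) + g u * (- 4 * (Fu * Gu))
    = 4 * r u ^+ 4 * Gu * (K / 4 * r u ^+ 2 / Gu * f u - Fu / r u ^+ 4 * g u).
    by field; rewrite r0.
  by rewrite e subrr mulr0.
split.
  have := ext rinf; rewrite G_rinf !mulr0 addr0; apply: mulIf0.
  by rewrite mulf_neq0// expf_neq0.
have := ext 0; rewrite F_0 G_0 expr0n !mulr0 add0r; apply: mulIf0.
by rewrite mulf_neq0 ?oppr_eq0 ?pnatr_eq0// mulf_neq0// expf_neq0.
Qed.

(** The equation is r^6 f = 4 fpol g, whose left side vanishes at r = 0, where
    fpol = q^2. *)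
Lemma separate_fibre_time f g : rc f -> rc g ->
  (forall p, D p -> w (r p) * f p = a (r p) * g p) ->
  forall p, D p -> f p = 0 /\ g p = 0.
Proof.
move=> rf rg fg p Dp; have [[r0 _ _] _ _ _] := region Dp.
have ext H x := @separate f g ('X ^+ 6) ((- 4) *: F) rf rg H p x Dp.
have g0 : g p = 0.
  have : f p * ('X ^+ 6).[0] + g p * (- 4 * F.[0]) = 0.
    move: (ext^~ 0); rewrite hornerZ; apply => u Du.
    have [[ru _ _] _ _ _] := region Du; have := fg u Du.
    rewrite /coef_fibre bh_fE// horner_exp hornerX hornerZ.
    move: F.[_] => x e.
    have -> : f u * r u ^+ 6 + g u * (- 4 * x)
      = 4 * r u ^+ 4 * (r u ^+ 2 / 4 * f u - x / r u ^+ 4 * g u).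
      by field.
    by rewrite e subrr mulr0.
  rewrite horner_exp hornerX F_0 expr0n mulr0 add0r; apply: mulIf0.
  by rewrite mulf_neq0 ?oppr_eq0 ?pnatr_eq0// expf_neq0.
by split=> //; apply: (mulIf0 (w_neq0 Dp)); rewrite mulrC fg// g0 mulr0.
Qed.

(** The equation is K f + gpol g = 0, and gpol vanishes at r = rinf. *)
Lemma separate_base_fibre f g : rc f -> rc g ->
  (forall p, D p -> h (r p) * f p + w (r p) * g p = 0) ->
  forall p, D p -> f p = 0 /\ g p = 0.
Proof.
move=> rf rg fg p Dp; have [[r0 _ R0] K0 _ G0] := region Dp.
have ext H x := @separate f g (K%:P) G rf rg H p x Dp.
have f0 : f p = 0.
  have : f p * (K%:P).[rinf] + g p * G.[rinf] = 0.
    apply: ext => u Du.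
    have [[ru _ _] _ _ Gu] := region Du; have := fg u Du.
    rewrite coef_baseE /coef_fibre hornerC; move: G.[_] Gu => x x0 e.
    have -> : f u * K + g u * x
      = 4 * x / r u ^+ 2 * (K / 4 * r u ^+ 2 / x * f u + r u ^+ 2 / 4 * g u).
      by field; rewrite ru x0.
    by rewrite e mulr0.
  by rewrite hornerC G_rinf mulr0 addr0; exact: mulIf0.
split=> //; apply: (mulIf0 (w_neq0 Dp)); rewrite mulrC.
by have := fg p Dp; rewrite f0 mulr0 add0r.
Qed.

(** The equation is r^4 f = fpol g, taken at r = 0. *)
Lemma separate_time f g : rc f -> rc g ->
  (forall p, D p -> f p = a (r p) * g p) -> forall p, D p -> g p = 0.
Proof.
move=> rf rg fg p Dp.
have ext H x := @separate f g ('X ^+ 4) ((- 1) *: F) rf rg H p x Dp.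
have : f p * ('X ^+ 4).[0] + g p * (- 1 * F.[0]) = 0.
  move: (ext^~ 0); rewrite hornerZ; apply => u Du; have [[ru _ _] _ _ _] := region Du.
  by rewrite (fg u Du) bh_fE// horner_exp hornerX hornerZ; field.
rewrite horner_exp hornerX F_0 expr0n mulr0 add0r; apply: mulIf0.
by rewrite mulf_neq0 ?oppr_eq0 ?oner_eq0// expf_neq0.
Qed.

(** The equation is 4 gpol f = K r^2 g, taken at r = rinf. *)
Lemma separate_base f g : rc f -> rc g ->
  (forall p, D p -> f p = h (r p) * g p) -> forall p, D p -> g p = 0.
Proof.
move=> rf rg fg p Dp; have [[_ _ R0] K0 _ _] := region Dp.
have ext H x := @separate f g (4 *: G) ((- K) *: 'X ^+ 2) rf rg H p x Dp.
have : f p * (4 * G.[rinf]) + g p * (- K * rinf ^+ 2) = 0.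
  move: (ext^~ rinf); rewrite horner_monomial hornerZ; apply => u Du.
  have [[ru _ _] _ _ Gu] := region Du.
  rewrite (fg u Du) coef_baseE horner_monomial hornerZ; by field.
rewrite G_rinf !mulr0 add0r; apply: mulIf0.
by rewrite mulf_neq0 ?oppr_eq0// expf_neq0.
Qed.

(** The equation is 4 f = r^2 g, taken at r = 0. *)
Lemma separate_fibre f g : rc f -> rc g ->
  (forall p, D p -> f p = w (r p) * g p) -> forall p, D p -> g p = 0.
Proof.
move=> rf rg fg p Dp; have [[r0 _ _] _ _ _] := region Dp.
have ext H x := @separate f g 1 ((- 4^-1) *: 'X ^+ 2) rf rg H p x Dp.
have f0 : f p = 0.
  have : f p * (1 : {poly R}).[0] + g p * (- 4^-1 * 0 ^+ 2) = 0.
    move: (ext^~ 0); rewrite horner_monomial; apply => u Du.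
    rewrite (fg u Du) /coef_fibre horner_monomial hornerC; by field.
  by rewrite hornerC mulr1 expr0n !mulr0 addr0.
by apply: (mulIf0 (w_neq0 Dp)); rewrite mulrC -fg.
Qed.

(** The Killing equations once rho and lam are known to vanish. *)
Let reduced p : D p -> exists a' b' h' w',
  killing_system a b h w p a' b' h' w' 0 0 (y 2 p) (fun nu i => N nu i p).
Proof.
move=> Dp; have [[r0 _ _] _ F0 G0] := region Dp.
have [a' [b' [h' [da db dh dw _]]]] := bh_coefficients_derive r0 F0 G0.
exists a', b', h', (r p / 2).
by have := killing Dp da db dh dw; rewrite lam0// rad0.
Qed.

Let a_neq0 p : D p -> a (r p) != 0.
Proof.
move=> Dp; have [[r0 _ _] _ F0 _] := region Dp.
by rewrite bh_fE// mulf_neq0// invr_neq0// expf_neq0.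
Qed.

Let N01_0 p : D p -> N 0 1 p = 0.
Proof.
move=> Dp; have [a' [b' [h' [w' [_ [e _ _ _] _ _]]]]] := reduced Dp.
by apply: (mulIf0 (a_neq0 Dp)); rewrite mulrC -e N1_0// mulr0.
Qed.

Let N21_0 p : D p -> N 2 1 p = 0.
Proof.
move=> Dp; have [a' [b' [h' [w' [_ _ [e _ _] _]]]]] := reduced Dp.
by apply: (mulIf0 (h_neq0 Dp)); move: e; rewrite N1_0// mulr0 add0r mulrC.
Qed.

Let Z1_0 p : D p -> N 4 1 p + cos (th p) * N 3 1 p = 0.
Proof.
move=> Dp; have [a' [b' [h' [w' [_ _ [_ _ e] _]]]]] := reduced Dp.
by apply: (mulIf0 (w_neq0 Dp)); move: e; rewrite N1_0// mulr0 add0r mulrC.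
Qed.

Let hs_neq0 p : D p -> h (r p) * sin (th p) ^+ 2 != 0.
Proof.
by move=> Dp; have [[_ s0 _] _ _ _] := region Dp; rewrite mulf_neq0 ?expf_neq0// h_neq0.
Qed.

Let N31_0 p : D p -> N 3 1 p = 0.
Proof.
move=> Dp; have [a' [b' [h' [w' [_ _ [_ e _] _]]]]] := reduced Dp.
apply: (mulIf0 (hs_neq0 Dp)); move: e.
by rewrite N1_0// Z1_0// !mulr0 add0r addr0 mulrC.
Qed.

Let N41_0 p : D p -> N 4 1 p = 0.
Proof. by move=> Dp; have := Z1_0 Dp; rewrite N31_0// mulr0 addr0. Qed.

Let dr0 nu : nu \in [:: 0; 2; 3; 4] -> partial D (d_x 1) (y nu) (fun=> 0).
Proof.
move=> nuE; apply: (partial_ext (dN nu 1)) => p Dp.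
by move: nuE; rewrite !inE => /or4P[] /eqP ->; [exact: N01_0|exact: N21_0|exact: N31_0|exact: N41_0].
Qed.

Let rcN nu i : nu \in [:: 0; 2; 3; 4] -> rc (N nu i).
Proof. by move=> nuE; exact: rc_mixed (sy nu) (dr0 nuE) (sN nu i) (dN nu i). Qed.

Let rcS nu : nu \in [:: 0; 2; 3; 4] -> rc (S nu).
Proof. by move=> nuE; exact: rc_mixed (sy nu) (dr0 nuE) (sS nu) (dS nu). Qed.

Let rcy nu : nu \in [:: 0; 2; 3; 4] -> rc (y nu).
Proof. by move=> nuE; split; [exact: sy|exact: dr0]. Qed.

Let rcB i : rc (B i).
Proof.
have B1_0 p : D p -> B 1 p = 0.
  by move=> Dp; have [_ -> _ _ _] := gauge Dp; rewrite S1_0// mulr0.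
apply: (rc_mixed sA _ (sB i) (dB i)).
by apply: (partial_ext (dB 1)) => p Dp; exact: B1_0.
Qed.

Let rcZ i : rc (fun p => N 4 i p + cos (th p) * N 3 i p).
Proof. by apply: rc_add; [exact: rcN|apply: rc_mul; [exact: rc_cos|exact: rcN]]. Qed.

Let rcs2 f : rc f -> rc (fun p => sin (th p) ^+ 2 * f p).
Proof.
move=> rf; apply: rc_mul => //.
exact: (rc_mul rc_sin rc_sin).
Qed.

Let N20_N02 p : D p -> N 2 0 p = 0 /\ N 0 2 p = 0.
Proof.
move=> Dp; apply: (separate_base_time (@rcN 2 0 isT) (@rcN 0 2 isT)) => // u Du.
by have [a' [b' [h' [w' [_ [_ e _ _] _ _]]]]] := reduced Du.
Qed.

Let Z0_N04 p : D p -> N 4 0 p + cos (th p) * N 3 0 p = 0 /\ N 0 4 p = 0.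
Proof.
move=> Dp; apply: (separate_fibre_time (rcZ 0) (@rcN 0 4 isT)) => // u Du.
by have [a' [b' [h' [w' [_ [_ _ _ e] _ _]]]]] := reduced Du.
Qed.

Let N30_N03 p : D p -> N 3 0 p = 0 /\ N 0 3 p = 0.
Proof.
move=> Dp; have [[_ s0 _] _ _ _] := region Dp.
have [|e ->] := separate_base_time (rcs2 (@rcN 3 0 isT)) (@rcN 0 3 isT) _ Dp.
  move=> u Du; have [a' [b' [h' [w' [_ [_ _ e _] _ _]]]]] := reduced Du.
  by move: e; rewrite (Z0_N04 Du).1 mulr0 addr0 mulrA.
by split=> //; apply: (mulIf0 (expf_neq0 2 s0)); rewrite mulrC.
Qed.

Lemma time_component_constant p (i : 'I_5) : D p -> N 0 i p = 0.
Proof.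
move=> Dp; elim/ord5_ind: i.
- have [a' [b' [h' [w' [[e _ _ _ _] _ _ _]]]]] := reduced Dp.
  have a20 : 2 * a (r p) != 0 by rewrite mulf_neq0 ?pnatr_eq0// a_neq0.
  by apply: (mulIf0 a20); move: e; rewrite mulr0 add0r mul0r mulrC.
- exact: N01_0.
- exact: (N20_N02 Dp).2.
- exact: (N30_N03 Dp).2.
- exact: (Z0_N04 Dp).2.
Qed.

Let N40_0 p : D p -> N 4 0 p = 0.
Proof. by move=> Dp; have := (Z0_N04 Dp).1; rewrite (N30_N03 Dp).1 mulr0 addr0. Qed.

Let N24_Z2 p : D p -> N 2 4 p = 0 /\ N 4 2 p + cos (th p) * N 3 2 p = 0.
Proof.
move=> Dp; apply: (separate_base_fibre (@rcN 2 4 isT) (rcZ 2)) => // u Du.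
by have [a' [b' [h' [w' [_ _ _ [_ e _]]]]]] := reduced Du.
Qed.

Let Z4_0 p : D p -> N 4 4 p + cos (th p) * N 3 4 p = 0.
Proof.
move=> Dp; have [a' [b' [h' [w' [[_ _ _ _ e] _ _ _]]]]] := reduced Dp.
have w20 : 2 * w (r p) != 0 by rewrite mulf_neq0 ?pnatr_eq0// w_neq0.
by apply: (mulIf0 w20); move: e; rewrite mulr0 add0r !mul0r mulrC.
Qed.

Let N34_Z3 p : D p -> N 3 4 p = 0 /\
  N 4 3 p + cos (th p) * N 3 3 p + - 1 * (sin (th p) * y 2 p) = 0.
Proof.
move=> Dp; have [[_ s0 _] _ _ _] := region Dp.
have rcV : rc (fun p => N 4 3 p + cos (th p) * N 3 3 p + - 1 * (sin (th p) * y 2 p)).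
  apply: rc_add; first exact: rcZ.
  by apply: rc_mul; [exact: rc_cst|apply: rc_mul; [exact: rc_sin|exact: rcy]].
have [|e ->] := separate_base_fibre (rcs2 (@rcN 3 4 isT)) rcV _ Dp.
  move=> u Du; have [a' [b' [h' [w' [_ _ _ [_ _ e]]]]]] := reduced Du.
  move: e; rewrite Z4_0// => /eqP; rewrite -subr_eq0 => /eqP <-; ring.
by split=> //; apply: (mulIf0 (expf_neq0 2 s0)); rewrite mulrC.
Qed.

Lemma theta_component p : D p ->
  [/\ N 2 0 p = 0, N 2 1 p = 0, N 2 2 p = 0 & N 2 4 p = 0].
Proof.
move=> Dp; split; [exact: (N20_N02 Dp).1|exact: N21_0| |exact: (N24_Z2 Dp).1].
have [a' [b' [h' [w' [[_ _ e _ _] _ _ _]]]]] := reduced Dp.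
have h20 : 2 * h (r p) != 0 by rewrite mulf_neq0 ?pnatr_eq0// h_neq0.
by apply: (mulIf0 h20); move: e; rewrite mulr0 add0r !mul0r mulrC.
Qed.

Lemma phi_component p : D p ->
  [/\ N 3 0 p = 0, N 3 1 p = 0, sin (th p) ^+ 2 * N 3 2 p = - N 2 3 p,
      sin (th p) * N 3 3 p = - (cos (th p) * y 2 p) & N 3 4 p = 0].
Proof.
move=> Dp; have [[_ s0 _] _ _ _] := region Dp.
have [a' [b' [h' [w' [[_ _ _ pp _] _ _ [tp _ _]]]]]] := reduced Dp.
split; [exact: (N30_N03 Dp).1|exact: N31_0| | |exact: (N34_Z3 Dp).1].
- have e : N 2 3 p + sin (th p) ^+ 2 * N 3 2 p = 0.
    apply: (mulIf0 (h_neq0 Dp)); move: tp; rewrite (N24_Z2 Dp).2 mulr0 addr0.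
    by rewrite mulrC.
  by apply/eqP; rewrite -addr_eq0 addrC e.
- have V := (N34_Z3 Dp).2.
  have hs0 : 2 * (h (r p) * sin (th p)) != 0.
    by rewrite mulf_neq0 ?pnatr_eq0// mulf_neq0// h_neq0.
  have e : sin (th p) * N 3 3 p + cos (th p) * y 2 p = 0.
    apply: (mulIf0 hs0); rewrite -[RHS](mul0r (h (r p) * sin (th p) ^+ 2 + w (r p) * cos (th p) ^+ 2)).
    rewrite -pp mulr0 add0r.
    apply/eqP; rewrite -subr_eq0; apply/eqP.
    rewrite -[RHS](mulr0 (- (2 * w (r p) * cos (th p)))) -V; ring.
  by apply/eqP; rewrite -addr_eq0 e.
Qed.

Lemma psi_component p : D p ->
  [/\ N 4 0 p = 0, N 4 1 p = 0, N 4 2 p = - (cos (th p) * N 3 2 p),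
      N 4 3 p = sin (th p) * y 2 p - cos (th p) * N 3 3 p & N 4 4 p = 0].
Proof.
move=> Dp; split; [exact: N40_0|exact: N41_0| | |].
- by apply/eqP; rewrite -addr_eq0 (N24_Z2 Dp).2.
- apply/eqP; rewrite -subr_eq0 -[X in _ == X](N34_Z3 Dp).2; apply/eqP; ring.
- by have := Z4_0 Dp; rewrite (N34_Z3 Dp).1 mulr0 addr0.
Qed.

(** By (gauge) the derivative of A in x^i is a metric coefficient times a
    component of d eta/ds. Both this derivative and the component are
    independent of r, because A_r = 0, while the coefficient does depend on
    r. *)
Lemma autonomous p (nu : 'I_5) : D p -> S nu p = 0.
Proof.
move=> Dp.
have S0 u : D u -> S 0 u = 0.
  apply: (separate_time (rc_mul (rc_cst (- 2^-1)) (rcB 0)) (@rcS 0 isT)) => v Dv.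
  have [-> _ _ _ _] := gauge Dv; by field.
have S2 u : D u -> S 2 u = 0.
  apply: (separate_base (rc_mul (rc_cst (2^-1)) (rcB 2)) (@rcS 2 isT)) => v Dv.
  have [_ _ -> _ _] := gauge Dv; by field.
have SZ u : D u -> S 4 u + cos (th u) * S 3 u = 0.
  have rcSZ : rc (fun p => S 4 p + cos (th p) * S 3 p).
    by apply: rc_add; [exact: rcS|apply: rc_mul; [exact: rc_cos|exact: rcS]].
  apply: (separate_fibre (rc_mul (rc_cst (2^-1)) (rcB 4)) rcSZ) => v Dv.
  have [_ _ _ _ ->] := gauge Dv; by field.
have S3 u : D u -> S 3 u = 0.
  move=> Du; have [[_ s0 _] _ _ _] := region Du.
  apply: (mulIf0 (expf_neq0 2 s0)); rewrite mulrC.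
  move: u Du {s0}; apply: (separate_base (rc_mul (rc_cst (2^-1)) (rcB 3)) (rcs2 (@rcS 3 isT))) => v Dv.
  have [_ _ _ -> _] := gauge Dv; rewrite SZ// mulr0 addr0; by field.
elim/ord5_ind: nu => //; [exact: S0|exact: S1_0|exact: S2|exact: S3|].
by have := SZ _ Dp; rewrite S3// mulr0 addr0.
Qed.

(** With y 2 = eta^th, the pair (y 2, Q) is a solution of the harmonic oscillator
    in ph; its phase plane carries two of the three rotations. *)
Let Q := N 2 3.

Let zero_partial v f : (forall p, D p -> f p = 0) -> partial D v f (fun=> 0).
Proof.
move=> f0; apply: (partial_eq oD (F := fun=> 0) (F' := fun=> 0)) => // p Dp.
  by rewrite f0.
exact: is_derive_const.
Qed.

Let Q_swap v g : partial D v (y 2) g -> (forall p, D p -> g p = 0) ->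
  partial D v Q (fun=> 0).
Proof.
move=> dg g0; have d0 : partial D v (y 2) (fun=> 0).
  exact: partial_ext dg g0.
by apply: (partial_swap oD (sy 2) d0 (dN 2 3) (sN 2 3)); exact: zero_partial.
Qed.

(** Integrability of the (th ph) and (ph ph) equations: the mixed derivative of
    eta^ph in th and ph is computed from each of them. *)
Let dQ3 : partial D (d_x 3) Q (fun p => - y 2 p).
Proof.
have [N323 s323 d323] := smooth_partial (d_x 3) (sN 3 2).
have d332 : partial D (d_x 2) (N 3 3) N323 := partial_swap oD (sy 3) (dN 3 2) (dN 3 3) (sN 3 3) d323.
have [Q3 sQ3 dQ3] := smooth_partial (d_x 3) (sN 2 3).
apply: (partial_ext dQ3) => p Dp.
have i1 u : D u -> sin (th u) ^+ 2 * N 3 2 u + Q u = 0.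
  by move=> Du; have [_ _ -> _ _] := phi_component Du; rewrite addNr.
have i2 u : D u -> sin (th u) * N 3 3 u + cos (th u) * y 2 u = 0.
  by move=> Du; have [_ _ _ -> _] := phi_component Du; rewrite addNr.
have d2 := dN 2 2.
have e1 : sin (th p) ^+ 2 * N323 p + Q3 p = 0.
  apply: (derive_zero oD i1 Dp (v := d_x 3)); apply: is_derive_eq; first by isd Dp.
  rewrite !d_x_entry /=; ring.
have e2 : cos (th p) * N 3 3 p + sin (th p) * N323 p - sin (th p) * y 2 p = 0.
  apply: (derive_zero oD i2 Dp (v := d_x 2)); apply: is_derive_eq; first by isd Dp.
  have [_ _ -> _] := theta_component Dp; rewrite !d_x_entry /=; ring.
have e3 := i2 p Dp; have cs := cos2Dsin2 (th p).
apply/eqP; rewrite -subr_eq0; apply/eqP.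
transitivity (sin (th p) ^+ 2 * N323 p + Q3 p
  - sin (th p) * (cos (th p) * N 3 3 p + sin (th p) * N323 p - sin (th p) * y 2 p)
  + cos (th p) * (sin (th p) * N 3 3 p + cos (th p) * y 2 p)
  - (cos (th p) ^+ 2 + sin (th p) ^+ 2 - 1) * y 2 p); first by ring.
by rewrite e1 e2 e3 cs subrr !mulr0 mul0r !subr0 addr0.
Qed.

(** One formula for all six directions, in terms of the th and ph components of
    v, so that constancy of each combination below is a single computation. *)
Lemma rotation_partials v : v = d_s \/ (exists i : 'I_5, v = d_x i) ->
  [/\ partial D v (y 2) (fun p => v.2 0 3 * Q p),
      partial D v Q (fun p => - (v.2 0 3 * y 2 p)),
      partial D v (y 3) (fun p => - (v.2 0 2 * Q p / sin (th p) ^+ 2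
         + v.2 0 3 * cos (th p) / sin (th p) * y 2 p)) &
      partial D v (y 4) (fun p => v.2 0 2 * cos (th p) / sin (th p) ^+ 2 * Q p
         + v.2 0 3 / sin (th p) * y 2 p)].
Proof.
case=> [->|[i ->]].
  have z i : (@d_s R).2 0 i = 0 by rewrite /= mxE.
  split.
  - by apply: (partial_ext (dS 2)) => p Dp; rewrite z mul0r autonomous.
  - apply: (@partial_ext _ _ _ _ (fun=> 0)) => [|p Dp]; last by rewrite z mul0r oppr0.
    by apply: (Q_swap (dS 2)) => p Dp; exact: autonomous.
  - by apply: (partial_ext (dS 3)) => p Dp; rewrite !z !mul0r addr0 oppr0 autonomous.
  - by apply: (partial_ext (dS 4)) => p Dp; rewrite !z !mul0r addr0 autonomous.
have s0 p : D p -> sin (th p) != 0 by move=> Dp; have [[_ s0 _] _ _ _] := region Dp.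
have N32E p : D p -> N 3 2 p = - (Q p / sin (th p) ^+ 2).
  move=> Dp; have [_ _ e _ _] := phi_component Dp.
  by rewrite -mulNr -e mulrC mulKf// expf_neq0// s0.
have N33E p : D p -> N 3 3 p = - (cos (th p) / sin (th p) * y 2 p).
  move=> Dp; have [_ _ _ e _] := phi_component Dp.
  by apply: (mulfI (s0 _ Dp)); rewrite e; field; exact: s0.
split.
- apply: (partial_ext (dN 2 i)) => p Dp; rewrite d_x_entry.
  have [e0 e1 e2 e4] := theta_component Dp.
  by elim/ord5_ind: i => /=; rewrite ?mul0r ?mul1r.
- apply: (@partial_ext _ _ _ _ (fun p => - ((3 == i)%:R * y 2 p))) => [|p Dp]; last first.
    by rewrite d_x_entry.
  elim/ord5_ind: i => /=.
  + apply: (@partial_ext _ _ _ _ (fun=> 0)) => [|p Dp]; last by rewrite mul0r oppr0.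
    by apply: (Q_swap (dN 2 0)) => p Dp; have [] := theta_component Dp.
  + apply: (@partial_ext _ _ _ _ (fun=> 0)) => [|p Dp]; last by rewrite mul0r oppr0.
    by apply: (Q_swap (dN 2 1)) => p Dp; have [] := theta_component Dp.
  + apply: (@partial_ext _ _ _ _ (fun=> 0)) => [|p Dp]; last by rewrite mul0r oppr0.
    by apply: (Q_swap (dN 2 2)) => p Dp; have [] := theta_component Dp.
  + by apply: (partial_ext dQ3) => p Dp; rewrite mul1r.
  + apply: (@partial_ext _ _ _ _ (fun=> 0)) => [|p Dp]; last by rewrite mul0r oppr0.
    by apply: (Q_swap (dN 2 4)) => p Dp; have [] := theta_component Dp.
- apply: (partial_ext (dN 3 i)) => p Dp; rewrite !d_x_entry.
  have [e0 e1 _ _ e4] := phi_component Dp.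
  elim/ord5_ind: i => /=; rewrite ?mul0r ?mul1r ?add0r ?addr0 ?oppr0//.
  + exact: N32E.
  + exact: N33E.
- apply: (partial_ext (dN 4 i)) => p Dp; rewrite !d_x_entry.
  have [e0 e1 e2 e3 e4] := psi_component Dp.
  elim/ord5_ind: i => /=; rewrite ?mul0r ?mul1r ?add0r ?addr0 ?oppr0//.
  + rewrite e2 N32E//; ring.
  + rewrite e3 N33E//; have := s0 _ Dp; have := cos2Dsin2 (th p).
    move: (cos _) (sin _) => c s cs sn0.
    apply: (mulfI sn0); transitivity ((c ^+ 2 + s ^+ 2) * y 2 p); first by field.
    by rewrite cs mul1r mulVKf.
Qed.

Variables (x0 : J -> R).
Hypotheses (sx0 : smooth_on D x0) (dx0 : forall i : 'I_5, partial D (d_x i) x0 (fun=> 0))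
  (dsx0 : partial D d_s x0 lam).
Hypotheses (U_neq0 : U !=set0) (U_connected : connected U).
Local Notation ph p := (p.2 0 3).

Lemma constant_of_partials f : smooth_on D f ->
  (forall v, v = d_s \/ (exists i : 'I_5, v = d_x i) -> partial D v f (fun=> 0)) ->
  exists c, forall p, D p -> f p = c.
Proof.
move=> sf df; have [x Ux] := U_neq0; exists (f (0, x)) => p Dp.
apply: (constant_on_strip oU U_connected) => // [u Du|u Du|u i Du].
- exact: smooth_on_differentiable sf Du.
- by rewrite (partialE (df _ (or_introl erefl)) Du).
- by rewrite (partialE (df _ (or_intror (ex_intro _ i erefl))) Du).
Qed.

(** The constants are xi, eta^t, eta^ph - cot th Q, eta^ps + csc th Q, and the
    two amplitudes sin ph eta^th + cos ph Q and cos ph eta^th - sin ph Q of the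
    oscillator. *)
Lemma symmetry_components : exists c1 c2 c3 c4 c5 c6 : R, forall p, D p ->
  let cth := cos (th p) / sin (th p) in let csth := (sin (th p))^-1 in
  [/\ x0 p = c1,
      y 0 p = c2 /\ y 1 p = 0,
      y 2 p = c5 * sin (ph p) + c6 * cos (ph p),
      y 3 p = c3 + c5 * (cos (ph p) * cth) - c6 * (sin (ph p) * cth) &
      y 4 p = c4 - c5 * (cos (ph p) * csth) + c6 * (sin (ph p) * csth)].
Proof.
have s0 p : D p -> sin (th p) != 0 by move=> Dp; have [[_ s0 _] _ _ _] := region Dp.
have elem (i : 'I_5) : elementary D (fun p : J => p.2 0 i).
  by apply: elem_smooth; exact: smooth_entry.
have eQ : elementary D Q by apply: elem_smooth; exact: sN.
have ey nu : elementary D (y nu) by apply: elem_smooth; exact: sy.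
have ec c : elementary D (fun=> c) by apply: elem_smooth; exact: smooth_on_cst.
have [c1 c1E] : exists c, forall p, D p -> x0 p = c.
  apply: constant_of_partials => // v [->|[i ->]]; last exact: dx0.
  by apply: (partial_ext dsx0) => p Dp; exact: lam0.
have [c2 c2E] : exists c, forall p, D p -> y 0 p = c.
  apply: constant_of_partials => // v [->|[i ->]].
    by apply: (partial_ext (dS 0)) => p Dp; exact: autonomous.
  by apply: (partial_ext (dN 0 i)) => p Dp; exact: time_component_constant.
have [c5 c5E] : exists c, forall p, D p -> sin (ph p) * y 2 p + cos (ph p) * Q p = c.
  apply: constant_of_partials => [|v vE p Dp].
    apply: elementary_smooth => //.
    by apply: elem_add; apply: elem_mul => //; [exact: elem_sin|exact: elem_cos].
  have [d2 dQ _ _] := rotation_partials vE.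
  apply: is_derive_eq; first by isd Dp.
  rewrite /=; ring.
have [c6 c6E] : exists c, forall p, D p -> cos (ph p) * y 2 p + - (1) * (sin (ph p) * Q p) = c.
  apply: constant_of_partials => [|v vE p Dp].
    apply: elementary_smooth => //; apply: elem_add.
      by apply: elem_mul => //; exact: elem_cos.
    by apply: elem_mul => //; apply: elem_mul => //; exact: elem_sin.
  have [d2 dQ _ _] := rotation_partials vE.
  apply: is_derive_eq; first by isd Dp.
  rewrite /=; ring.
have [c3 c3E] : exists c, forall p, D p ->
    y 3 p + - (1) * (cos (th p) * (sin (th p))^-1 * Q p) = c.
  apply: constant_of_partials => [|v vE p Dp].
    apply: elementary_smooth => //; apply: elem_add => //.
    apply: elem_mul => //; apply: elem_mul => //; apply: elem_mul; first exact: elem_cos.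
    by apply: elem_inv => //; exact: elem_sin.
  have [_ dQ d3 _] := rotation_partials vE.
  have di : is_derive p v (fun u : J => (sin (th u))^-1)
      (- (cos (th p) * v.2 0 2 * ((sin (th p))^-1 * (sin (th p))^-1))).
    by apply: is_derive_inv; [exact: s0|isd Dp].
  apply: is_derive_eq; first by (isd Dp; exact: di).
  have := s0 _ Dp; have cs := cos2Dsin2 (th p).
  have {}cs : cos (th p) ^+ 2 = 1 - sin (th p) ^+ 2 by rewrite -cs addrK.
  by move: (cos (th p)) (sin (th p)) cs => c s cs sn0 /=; field: cs.
have [c4 c4E] : exists c, forall p, D p -> y 4 p + (sin (th p))^-1 * Q p = c.
  apply: constant_of_partials => [|v vE p Dp].
    apply: elementary_smooth => //; apply: elem_add => //; apply: elem_mul => //.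
    by apply: elem_inv => //; exact: elem_sin.
  have [_ dQ _ d4] := rotation_partials vE.
  have di : is_derive p v (fun u : J => (sin (th u))^-1)
      (- (cos (th p) * v.2 0 2 * ((sin (th p))^-1 * (sin (th p))^-1))).
    by apply: is_derive_inv; [exact: s0|isd Dp].
  apply: is_derive_eq; first by (isd Dp; exact: di).
  by have := s0 _ Dp; move: (cos (th p)) (sin (th p)) => c s sn0 /=; field.
exists c1, c2, c3, c4, c5, c6 => p Dp cth csth.
have cs := cos2Dsin2 (ph p).
have QE : Q p = c5 * cos (ph p) - c6 * sin (ph p).
  rewrite -(c5E _ Dp) -(c6E _ Dp) -[LHS]mul1r -[X in X * _ = _]cs; ring.
split; [exact: c1E|by rewrite c2E// rad0| | |].
- rewrite -(c5E _ Dp) -(c6E _ Dp) -[LHS]mul1r -[X in X * _ = _]cs; ring.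
- rewrite -(c3E _ Dp) QE /cth; ring.
- rewrite -(c4E _ Dp) QE /csth; ring.
Qed.

End KillingFields.

(** * The six generators *)

Section Fields.
Context {R : realType}.
Local Notation X := 'rV[R]_5.
Local Notation J := (R * 'rV[R]_5)%type.
Local Notation th p := (p.2 0 2).
Local Notation ph p := (p.2 0 3).

Definition generators : 6.-tuple (J -> J) :=
  [tuple bh_Y1; bh_Y2; bh_Y3; bh_Y4; bh_Y5; bh_Y6].

(** The th component of a combination of the generators, and its derivative in
    ph. *)
Definition wave (c : 'I_6 -> R) (f : R) : R := c 4 * sin f + c 5 * cos f.
Definition wave' (c : 'I_6 -> R) (f : R) : R := c 4 * cos f - c 5 * sin f.

(** The combination of the six generators with coefficients c, in coordinates. *)
Definition symmetric_field (c : 'I_6 -> R) (p : J) : J :=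
  (c 0, \row_(i < 5) [:: c 1; 0; wave c (ph p);
    c 2 + cos (th p) * (sin (th p))^-1 * wave' c (ph p);
    c 3 - (sin (th p))^-1 * wave' c (ph p)]`_i).

Lemma generators_sum c p :
  \sum_(i < 6) c i *: tnth generators i p = symmetric_field c p.
Proof.
have sum6 (F : 'I_6 -> J) :
    \sum_(i < 6) F i = F 0 + F 1 + F 2 + F 3 + F 4 + F 5.
  rewrite !big_ord_recl big_ord0 addr0 !addrA.
  by do ! congr (_ + _); congr F; apply/val_inj.
rewrite sum6 !(tnth_nth (fun=> 0)) /=.
apply/pair_equal_spec; split=> /=.
  rewrite /GRing.scale /=; ring.
apply/rowP; elim/ord5_ind; rewrite !mxE /= /cot /csc /wave /wave'; ring.
Qed.

Variables (U : set X) (oU : open U).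
Local Notation D := (setT `*` U : set J).
Hypothesis sin_neq0 : forall p, D p -> sin (th p) != 0.
Let oD : open D := open_strip oU.

Lemma smooth_component (Y : J -> J) nu : smooth_on D Y -> smooth_on D (eta Y nu).
Proof.
move=> sY; apply: (@smooth_on_linear _ _ _ oD _ _ (entry nu \o snd) Y) => //.
by move=> p; apply: continuous_comp; [exact: snd_continuous|exact: entry_continuous].
Qed.

Lemma smooth_xi (Y : J -> J) : smooth_on D Y -> smooth_on D (xi Y).
Proof.
by move=> sY; apply: (@smooth_on_linear _ _ _ oD _ _ fst Y) => //; exact: fst_continuous.
Qed.

Lemma smooth_on_scale {W : normedModType R} (f : J -> R) (v : W) :
  smooth_on D f -> smooth_on D (fun p => f p *: v).
Proof.
move=> sf.
have lin : linear (fun x : R => x *: v).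
  by move=> k x y; rewrite scalerDl scalerA.
pose L : {linear R -> W} := HB.pack (fun x : R => x *: v)
  (GRing.isLinear.Build _ _ _ _ _ lin).
by apply: (@smooth_on_linear _ _ _ oD _ _ L f) => //; exact: scalel_continuous.
Qed.

Lemma smooth_of_components (Y : J -> J) : smooth_on D (xi Y) ->
  (forall nu, smooth_on D (eta Y nu)) -> smooth_on D Y.
Proof.
move=> sx se; apply: (smooth_on_eq oD (F := fun p => xi Y p *: d_s
    + \sum_(nu < 5) eta Y nu p *: d_x nu)) => [p Dp|]; last first.
  apply: smooth_onD => //; first exact: smooth_on_scale.
  by apply: smooth_on_sum => // nu; exact: smooth_on_scale.
rewrite /xi /eta; case: (Y p) => s x; apply/pair_equal_spec; split=> /=.
  rewrite (raddf_sum fst)/= big1 ?addr0 => [|i _]; last by rewrite scaler0.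
  by rewrite -[s *: 1]/(s * 1) mulr1.
by rewrite (raddf_sum snd)/= scaler0 add0r -row_sum_delta.
Qed.

Lemma is_derive_wave c p v : is_derive p v (fun q : J => wave c (ph q))
  (wave' c (ph p) * v.2 0 3).
Proof.
apply: is_derive_eq; first by (rewrite /wave; isd I).
rewrite /wave'; ring.
Qed.

Lemma is_derive_wave' c p v : is_derive p v (fun q : J => wave' c (ph q))
  (- (wave c (ph p) * v.2 0 3)).
Proof.
apply: is_derive_eq; first by (rewrite /wave'; isd I).
rewrite /wave; ring.
Qed.

Lemma is_derive_csc (p v : J) : D p -> is_derive p v (fun q : J => (sin (th q))^-1)
  (- (cos (th p) * v.2 0 2 * ((sin (th p))^-1 * (sin (th p))^-1))).
Proof. by move=> Dp; apply: is_derive_inv; [exact: sin_neq0|isd Dp]. Qed.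

(** All hypotheses on Y hold on D only, since two fields that agree on D are the
    same element. *)
Section Components.
Variables (Y : J -> J) (c : 'I_6 -> R).
Hypothesis YE : forall p, D p -> Y p = symmetric_field c p.

Let near_component (g : J -> R) nu v d : (forall p, D p -> eta Y nu p = g p) ->
  (forall p, D p -> is_derive p v g (d p)) -> partial D v (eta Y nu) d.
Proof.
move=> e dg; apply: (partial_eq oD (F := g) (F' := d)) => // p Dp.
by rewrite e.
Qed.

Lemma partial_xi v : partial D v (xi Y) (fun=> 0).
Proof.
apply: (partial_eq oD (F := fun=> c 0) (F' := fun=> 0)) => // p Dp.
  by rewrite /xi YE.
exact: is_derive_const.
Qed.

Lemma partial_eta0 v : partial D v (eta Y 0) (fun=> 0).
Proof.
apply: (@near_component (fun=> c 1)) => p Dp.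
by rewrite /eta YE// /symmetric_field /= mxE.
Qed.

Lemma partial_eta1 v : partial D v (eta Y 1) (fun=> 0).
Proof.
apply: (@near_component (fun=> 0)) => p Dp.
by rewrite /eta YE// /symmetric_field /= mxE.
Qed.

Lemma partial_eta2 v : partial D v (eta Y 2) (fun p => wave' c (ph p) * v.2 0 3).
Proof.
apply: (@near_component (fun p => wave c (ph p))) => p Dp; last exact: is_derive_wave.
by rewrite /eta YE// /symmetric_field /= mxE.
Qed.

Lemma partial_eta3 v : partial D v (eta Y 3) (fun p =>
  - (v.2 0 2 * wave' c (ph p) / sin (th p) ^+ 2
     + v.2 0 3 * cos (th p) / sin (th p) * wave c (ph p))).
Proof.
apply: (@near_component (fun p => c 2 + cos (th p) * (sin (th p))^-1 * wave' c (ph p)))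
  => p Dp; first by rewrite /eta YE// /symmetric_field /= mxE.
apply: is_derive_eq.
  eapply is_derive_add; first exact: is_derive_const.
  eapply is_derive_mul; last exact: is_derive_wave'.
  by eapply is_derive_mul; [isd Dp|exact: is_derive_csc].
have sn0 := sin_neq0 Dp.
have cs : cos (th p) ^+ 2 = 1 - sin (th p) ^+ 2 by rewrite -(cos2Dsin2 (th p)) addrK.
by move: (cos (th p)) (sin (th p)) cs sn0 => x s cs sn0 /=; field: cs.
Qed.

Lemma partial_eta4 v : partial D v (eta Y 4) (fun p =>
  v.2 0 2 * cos (th p) / sin (th p) ^+ 2 * wave' c (ph p)
  + v.2 0 3 / sin (th p) * wave c (ph p)).
Proof.
apply: (@near_component (fun p => c 3 + - ((sin (th p))^-1 * wave' c (ph p))))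
  => p Dp; first by rewrite /eta YE// /symmetric_field /= mxE.
apply: is_derive_eq.
  eapply is_derive_add; first exact: is_derive_const.
  eapply is_derive_opp; eapply is_derive_mul; last exact: is_derive_wave'.
  exact: is_derive_csc.
by have := sin_neq0 Dp; move: (cos (th p)) (sin (th p)) => x s sn0 /=; field.
Qed.

Lemma smooth_symmetric_field : smooth_on D Y.
Proof.
have entryE (i : 'I_5) : elementary D (fun p : J => p.2 0 i).
  by apply: elem_smooth; exact: smooth_entry.
have ec k : elementary D (fun=> k) by apply: elem_smooth; exact: smooth_on_cst.
have ew : elementary D (fun p => wave c (ph p)).
  by apply: elem_add; apply: elem_mul => //; [exact: elem_sin|exact: elem_cos].
have ew' : elementary D (fun p => c 4 * cos (ph p) + (- c 5) * sin (ph p)).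
  by apply: elem_add; apply: elem_mul => //; [exact: elem_cos|exact: elem_sin].
have es : elementary D (fun p : J => (sin (th p))^-1).
  by apply: elem_inv => //; exact: elem_sin.
have ecos : elementary D (fun p : J => cos (th p)) by exact: elem_cos.
have comp nu (g : J -> R) : (forall p, D p -> g p = eta Y nu p) -> elementary D g ->
    smooth_on D (eta Y nu).
  by move=> e eg; apply: (smooth_on_eq oD e); exact: elementary_smooth.
apply: smooth_of_components.
  apply: (smooth_on_eq oD (F := fun=> c 0)); last exact: smooth_on_cst.
  by move=> p Dp; rewrite /xi YE.
elim/ord5_ind.
- apply: (comp _ (fun=> c 1)) => // p Dp; by rewrite /eta YE// /symmetric_field /= mxE.
- apply: (comp _ (fun=> 0)) => // p Dp; by rewrite /eta YE// /symmetric_field /= mxE.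
- apply: (comp _ _ _ ew) => // p Dp; by rewrite /eta YE// /symmetric_field /= mxE.
- apply: (comp _ _ _ (elem_add (ec (c 2)) (elem_mul (elem_mul ecos es) ew'))) => // p Dp.
  by rewrite /eta YE// /symmetric_field /= mxE /= /wave' mulNr.
- apply: (comp _ _ _ (elem_add (ec (c 3)) (elem_mul (ec (-1)) (elem_mul es ew')))) => // p Dp.
  rewrite /eta YE// /symmetric_field /= mxE /= /wave'; ring.
Qed.

End Components.

End Fields.

(** * Classification of the Noether symmetries *)

Section Classification.
Context {R : realType}.
Local Notation X := 'rV[R]_5.
Local Notation J := (R * 'rV[R]_5)%type.
Variables (M q rinf : R) (U : set X).
Hypotheses (q_neq0 : q != 0) (U_neq0 : U !=set0) (oU : open U)
  (U_connected : connected U) (U_region : U `<=` bh_region M q rinf).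
Local Notation D := (setT `*` U : set J).
Local Notation th p := (p.2 0 2).
Local Notation ph p := (p.2 0 3).
Local Notation L := (bh_lagrangian M q rinf).
Let oD : open D := open_strip oU.

Let sin_neq0 p : D p -> sin (th p) != 0.
Proof. by move=> [_ /= Up]; have [[]] := bh_region_neq0 (U_region Up). Qed.

(** The data of [symmetry_components] are the components of Y and of the gauge
    function with their derivatives; [noether_equations] supplies the
    equations. *)
Lemma symmetry_is_field (Y : J -> J) : noether_symmetry D L Y ->
  exists c, forall p, D p -> Y p = symmetric_field c p.
Proof.
move=> [sY [A [sA E]]].
have eqs p : D p -> forall a' b' h' w',
    is_derive (p.2 0 1) 1 (bh_f M q) a' -> is_derive (p.2 0 1) 1 (coef_r M q rinf) b' ->
    is_derive (p.2 0 1) 1 (coef_base M q rinf) h' -> is_derive (p.2 0 1) 1 coef_fibre w' ->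
    [/\ forall mu, 'D_(d_x mu) (xi Y) p = 0,
      killing_system (bh_f M q) (coef_r M q rinf) (coef_base M q rinf) coef_fibre p
        a' b' h' w' ('D_d_s (xi Y) p) (eta Y 1 p) (eta Y 2 p)
        (fun nu mu => 'D_(d_x mu) (eta Y nu) p) &
      gauge_system (bh_f M q) (coef_r M q rinf) (coef_base M q rinf) coef_fibre p
        (fun nu => 'D_d_s (eta Y nu) p) (fun mu => 'D_(d_x mu) A p)].
  move=> Dp a' b' h' w' da db dh dw.
  have [[r0 _ _] K0 F0 G0] := bh_region_neq0 (U_region Dp.2).
  apply: noether_equations => //.
  - by rewrite bh_fE// mulf_neq0// invr_neq0// expf_neq0.
  - rewrite coef_rE//; apply: mulf_neq0; first by rewrite mulf_neq0// expf_neq0.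
    by rewrite invr_neq0// npolE mulf_neq0// expf_neq0.
  - rewrite coef_baseE; apply: mulf_neq0; last by rewrite invr_neq0.
    by rewrite mulf_neq0 ?expf_neq0// mulf_neq0// invr_neq0// pnatr_eq0.
  - by rewrite /coef_fibre mulf_neq0 ?expf_neq0// invr_neq0// pnatr_eq0.
  - by move=> v; rewrite -bh_lagE; exact: E.
have some_derivatives p : D p -> exists a' b' h' w',
    [/\ is_derive (p.2 0 1) 1 (bh_f M q) a', is_derive (p.2 0 1) 1 (coef_r M q rinf) b',
      is_derive (p.2 0 1) 1 (coef_base M q rinf) h' & is_derive (p.2 0 1) 1 coef_fibre w'].
  move=> Dp; have [[r0 _ _] K0 F0 G0] := bh_region_neq0 (U_region Dp.2).
  have [a' [b' [h' [da db dh dw _]]]] := bh_coefficients_derive r0 F0 G0.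
  by exists a', b', h', (p.2 0 1 / 2).
have sxi := smooth_xi oU sY; have seta nu := smooth_component oU nu sY.
have slam := smooth_on_derive d_s sxi.
have dxi (i : 'I_5) : partial D (d_x i) (xi Y) (fun=> 0).
  apply: (partial_ext (partial_self (d_x i) sxi)) => p Dp.
  have [a' [b' [h' [w' [da db dh dw]]]]] := some_derivatives p Dp.
  by have [-> _ _] := eqs p Dp _ _ _ _ da db dh dw.
have dlam (i : 'I_5) : partial D (d_x i) (fun q => 'D_d_s (xi Y) q) (fun=> 0).
  apply: (partial_swap oD sxi (dxi i) (partial_self d_s sxi) slam).
  by move=> p Dp; exact: is_derive_const.
have [c1 [c2 [c3 [c4 [c5 [c6 cE]]]]]] := @symmetry_components R M q rinf U q_neq0 oU
  U_region (fun q => 'D_d_s (xi Y) q) A (eta Y) (fun nu q => 'D_d_s (eta Y nu) q)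
  (fun i q => 'D_(d_x i) A q) (fun nu i q => 'D_(d_x i) (eta Y nu) q)
  slam dlam sA (fun i => smooth_on_derive _ sA) (fun i => partial_self _ sA)
  seta (fun nu i => smooth_on_derive _ (seta nu)) (fun nu i => partial_self _ (seta nu))
  (fun nu => smooth_on_derive _ (seta nu)) (fun nu => partial_self _ (seta nu))
  (fun p Dp a' b' h' w' da db dh dw => let: And3 _ k _ := eqs p Dp a' b' h' w' da db dh dw in k)
  (fun p Dp => let: ex_intro a' (ex_intro b' (ex_intro h' (ex_intro w' (And4 da db dh dw)))) :=
     some_derivatives p Dp in let: And3 _ _ g := eqs p Dp a' b' h' w' da db dh dw in g)
  (xi Y) sxi dxi (partial_self d_s sxi) U_neq0 U_connected.
exists (fun i => [:: c1; c2; c3; c4; c5; c6]`_i) => p Dp.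
have [x0 [y0 y1] y2 y3 y4] := cE p Dp.
rewrite /symmetric_field [LHS]surjective_pairing -/(xi Y p) x0.
apply/pair_equal_spec; split=> //; apply/rowP.
elim/ord5_ind; rewrite mxE -/(eta Y _ p) /=.
- by rewrite y0.
- by rewrite y1.
- by rewrite y2.
- rewrite y3 /wave' /=; ring.
- rewrite y4 /wave' /=; ring.
Qed.

(** With zero gauge and constant xi, the condition reduces to
    L_eta g = 0, checked by cos^2 th = 1 - sin^2 th. *)
Lemma field_is_symmetry (Y : J -> J) c : (forall p, D p -> Y p = symmetric_field c p) ->
  noether_symmetry D L Y.
Proof.
move=> YE; split; first exact: smooth_symmetric_field YE.
exists (fun=> 0); split=> [|p v Dp]; first exact: smooth_on_cst.
have [[r0 _ _] K0 F0 G0] := bh_region_neq0 (U_region Dp.2).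
have [a' [b' [h' [da db dh dw _]]]] := bh_coefficients_derive r0 F0 G0.
have xi0 u : 'D_u (xi Y) p = 0 by rewrite (partialE (partial_xi oU YE u) Dp).
rewrite bh_lagE (prolong1_lag da db dh dw) /total_s !sum5 !xi0 !derive_cst.
have e1 : eta Y 1 p = 0 by rewrite /eta YE// /symmetric_field /= mxE.
have e2 : eta Y 2 p = wave c (ph p) by rewrite /eta YE// /symmetric_field /= mxE.
rewrite e1 e2 !mulr0 !mul0r !addr0 add0r /lag_metric !mxE !sum5 !xi0.
rewrite !(partialE (partial_eta0 oU YE _) Dp) !(partialE (partial_eta1 oU YE _) Dp).
rewrite !(partialE (partial_eta2 oU YE _) Dp).
rewrite !(partialE (partial_eta3 oU sin_neq0 YE _) Dp).
rewrite !(partialE (partial_eta4 oU sin_neq0 YE _) Dp) !d_x_entry /= !mxE /lag_th.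
have sn0 := sin_neq0 Dp.
have cs : cos (th p) ^+ 2 = 1 - sin (th p) ^+ 2 by rewrite -(cos2Dsin2 (th p)) addrK.
move: (bh_f _ _ _) (coef_r _ _ _ _) (coef_base _ _ _ _) (coef_fibre _) => a b h w.
move: (wave c _) (wave' c _) => W W'.
move: (cos (th p)) (sin (th p)) cs sn0 => x s cs sn0.
by field: cs.
Qed.

(** The bracket of so(3) on the coefficients of Y3, Y5, Y6, and zero on the
    central generators Y1, Y2, Y4. *)
Definition bracket_coef (c d : 'I_6 -> R) (i : 'I_6) : R :=
  [:: 0; 0; c 4 * d 5 - c 5 * d 4; 0; c 5 * d 2 - c 2 * d 5; c 2 * d 4 - c 4 * d 2]`_i.

Lemma derive_components (Z : J -> J) p v : smooth_on D Z -> D p ->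
  ('D_v Z p).1 = 'D_v (xi Z) p /\ forall nu, ('D_v Z p).2 0 nu = 'D_v (eta Z nu) p.
Proof.
move=> sZ Dp; have dZ := smooth_on_differentiable sZ Dp; split=> [|nu].
  have d := is_derive_linear_comp v (@fst_continuous R) dZ.
  by rewrite -[LHS]/(fst ('D_v Z p)); apply/esym; exact: derive_val.
have cL : continuous (entry nu \o snd : J -> R).
  by move=> u; apply: continuous_comp; [exact: snd_continuous|exact: entry_continuous].
have d := @is_derive_linear_comp _ _ _ _ (entry nu \o snd) Z p v cL dZ.
by apply/esym; exact: derive_val.
Qed.

Lemma entry_sub (u v : J) nu : (u - v).2 0 nu = u.2 0 nu - v.2 0 nu.
Proof. by rewrite /= !mxE. Qed.

Lemma symmetric_field_entry c (p : J) :
  [/\ (symmetric_field c p).2 0 0 = c 1, (symmetric_field c p).2 0 1 = 0,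
      (symmetric_field c p).2 0 2 = wave c (ph p),
      (symmetric_field c p).2 0 3 =
        c 2 + cos (th p) * (sin (th p))^-1 * wave' c (ph p) &
      (symmetric_field c p).2 0 4 = c 3 - (sin (th p))^-1 * wave' c (ph p)].
Proof. by split; rewrite /= mxE. Qed.

Lemma bracket_components (Y Z : J -> J) p : smooth_on D Y -> smooth_on D Z -> D p ->
  (lie_bracket Y Z p).1 = 'D_(Y p) (xi Z) p - 'D_(Z p) (xi Y) p /\
  forall nu, (lie_bracket Y Z p).2 0 nu
    = 'D_(Y p) (eta Z nu) p - 'D_(Z p) (eta Y nu) p.
Proof.
move=> sY sZ Dp.
have [Y1 Y2] := derive_components (Z p) sY Dp.
have [Z1 Z2] := derive_components (Y p) sZ Dp.
by split=> [|nu]; [rewrite -Y1 -Z1|rewrite -Y2 -Z2 -entry_sub].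
Qed.

Lemma bracket_field (Y Z : J -> J) c d :
  (forall p, D p -> Y p = symmetric_field c p) ->
  (forall p, D p -> Z p = symmetric_field d p) ->
  forall p, D p -> lie_bracket Y Z p = symmetric_field (bracket_coef c d) p.
Proof.
move=> YE ZE p Dp.
have [B1 B2] := bracket_components (smooth_symmetric_field oU sin_neq0 YE)
  (smooth_symmetric_field oU sin_neq0 ZE) Dp.
have [S0 S1 S2 S3 S4] := symmetric_field_entry (bracket_coef c d) p.
have [_ _ Yth Yph _] := symmetric_field_entry c p.
have [_ _ Zth Zph _] := symmetric_field_entry d p.
rewrite -YE// in Yth Yph; rewrite -ZE// in Zth Zph.
have sn0 := sin_neq0 Dp.
have cs : cos (th p) ^+ 2 = 1 - sin (th p) ^+ 2 by rewrite -(cos2Dsin2 (th p)) addrK.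
have cs' : cos (ph p) ^+ 2 = 1 - sin (ph p) ^+ 2 by rewrite -(cos2Dsin2 (ph p)) addrK.
have E1 : (lie_bracket Y Z p).1 = (symmetric_field (bracket_coef c d) p).1.
  by rewrite B1 (partialE (partial_xi oU ZE (Y p)) Dp)
    (partialE (partial_xi oU YE (Z p)) Dp) subrr.
have E2 nu : (lie_bracket Y Z p).2 0 nu = (symmetric_field (bracket_coef c d) p).2 0 nu.
  elim/ord5_ind: nu; rewrite B2.
  - by rewrite S0 (partialE (partial_eta0 oU ZE (Y p)) Dp)
      (partialE (partial_eta0 oU YE (Z p)) Dp) subrr.
  - by rewrite S1 (partialE (partial_eta1 oU ZE (Y p)) Dp)
      (partialE (partial_eta1 oU YE (Z p)) Dp) subrr.
  - rewrite S2 (partialE (partial_eta2 oU ZE (Y p)) Dp)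
      (partialE (partial_eta2 oU YE (Z p)) Dp) Yph Zph.
    rewrite /wave /wave' /bracket_coef /=.
    move: (cos (th p)) (sin (th p)) (cos (ph p)) (sin (ph p)) => x s x' s'.
    ring.
  - rewrite S3 (partialE (partial_eta3 oU sin_neq0 ZE (Y p)) Dp)
      (partialE (partial_eta3 oU sin_neq0 YE (Z p)) Dp) Yph Zph Yth Zth.
    rewrite /wave /wave' /bracket_coef /=.
    move: (cos (th p)) (sin (th p)) (cos (ph p)) (sin (ph p)) cs cs' sn0 => x s x' s' cs cs' sn0.
    by field: cs cs'.
  - rewrite S4 (partialE (partial_eta4 oU sin_neq0 ZE (Y p)) Dp)
      (partialE (partial_eta4 oU sin_neq0 YE (Z p)) Dp) Yph Zph Yth Zth.
    rewrite /wave /wave' /bracket_coef /=.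
    move: (cos (th p)) (sin (th p)) (cos (ph p)) (sin (ph p)) cs' sn0 => x s x' s' cs' sn0.
    by field: cs'.
case: (lie_bracket Y Z p) (symmetric_field _ p) E1 E2 {B1 B2 S0 S1 S2 S3 S4} => [s x] [s' x'] /= -> e.
by congr (_, _); apply/rowP => nu; exact: e.
Qed.

(** The th component and its ph-derivative are the two coordinates of a rotated
    copy of (c 4, c 5), so these vanish first. *)
Lemma symmetric_field_inj c : (forall p, D p -> symmetric_field c p = 0) ->
  forall i, c i = 0.
Proof.
move=> c0.
have comp p nu : D p -> (symmetric_field c p).2 0 nu = 0.
  by move=> Dp; rewrite c0//= mxE.
have [x Ux] := U_neq0; have Dx : D (0, x) by [].
have C0 : c 0 = 0 := congr1 fst (c0 _ Dx).
have C1 : c 1 = 0 by have := comp _ 0 Dx; rewrite /= mxE.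
have w0 p : D p -> wave c (ph p) = 0 by move=> Dp; have := comp p 2 Dp; rewrite /= mxE.
have w'0 p : D p -> wave' c (ph p) = 0.
  move=> Dp; have := derive_zero oD w0 Dp (is_derive_wave c p (d_x 3)).
  by rewrite d_x_entry mulr1.
have C2 : c 2 = 0.
  by have := comp _ 3 Dx; rewrite /= mxE /= (w'0 _ Dx) mulr0 addr0.
have C3 : c 3 = 0.
  by have := comp _ 4 Dx; rewrite /= mxE /= (w'0 _ Dx) mulr0 subr0.
have := w0 _ Dx; have := w'0 _ Dx; have := cos2Dsin2 (ph ((0, x) : J)).
move: (ph ((0, x) : J)) => f cs w'f wf.
have C4 : c 4 = 0.
  transitivity (sin f * wave c f + cos f * wave' c f); last by rewrite wf w'f !mulr0 addr0.
  rewrite -[LHS]mulr1 -cs /wave /wave'; ring.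
have C5 : c 5 = 0.
  transitivity (cos f * wave c f - sin f * wave' c f); last by rewrite wf w'f !mulr0 subr0.
  rewrite -[LHS]mulr1 -cs /wave /wave'; ring.
case=> [[|[|[|[|[|[|//]]]]]] i6]; [rewrite -[RHS]C0|rewrite -[RHS]C1|
  rewrite -[RHS]C2|rewrite -[RHS]C3|rewrite -[RHS]C4|rewrite -[RHS]C5]; congr c; exact/val_inj.
Qed.

End Classification.

Unset Implicit Arguments.

Theorem theorem6 (R : realType) (M q rinf : R) (U : set 'rV[R]_5)
    (q_neq0 : q != 0) (rinf_gt0 : 0 < rinf)
    (U_neq0 : U !=set0) (U_open : open U) (U_connected : connected U)
    (U_region : U `<=` bh_region M q rinf) :
  let D : set (R * 'rV[R]_5) := setT `*` U in
  let sym : set (R * 'rV[R]_5 -> R * 'rV[R]_5) :=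
    [set Y | noether_symmetry D (bh_lagrangian M q rinf) Y] in
  lie_algebra sym /\
  basis_on D sym [tuple bh_Y1; bh_Y2; bh_Y3; bh_Y4; bh_Y5; bh_Y6].
Proof.
move=> D sym.
have fwd := symmetry_is_field q_neq0 U_neq0 U_open U_connected U_region.
have bwd := field_is_symmetry U_open U_region.
split.
- split.
  + apply: (bwd _ (fun=> 0)) => p Dp; rewrite -generators_sum big1// => i _.
    by rewrite scale0r.
  + move=> a b Y Z /fwd[c YE] /fwd[d ZE]; apply: (bwd _ (fun i => a * c i + b * d i)).
    move=> p Dp; rewrite YE// ZE// -!generators_sum !scaler_sumr -big_split.
    by apply: eq_bigr => i _ /=; rewrite !scalerA scalerDl.
  + move=> Y Z /fwd[c YE] /fwd[d ZE].
    apply: (bwd _ (bracket_coef c d)) => p Dp.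
    exact: (bracket_field U_open U_region YE ZE Dp).
- split.
  + move=> i; apply: (bwd _ (fun j => (j == i)%:R)) => p Dp.
    rewrite -generators_sum (bigD1 i)//= (eqxx i) scale1r big1 ?addr0// => j /negbTE ->.
    by rewrite scale0r.
  + move=> c c0; apply: (symmetric_field_inj U_neq0 U_open) => p Dp.
    by rewrite -generators_sum; exact: c0.
  + move=> Y /fwd[c YE]; exists c => p Dp; rewrite YE//.
    exact/esym/generators_sum.
Qed.
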